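(* Let $\mathbb{S}$ be a left semistrict rig category with underlying category $\mathcal{S}$. For any sequence $x=(x_n)_{n\ge0}$ of objects of $\mathcal{S}$ with $x_n\cong\underline{n}$ for each $n$, and any sequence $\tau=(\tau_n)_{n\ge0}$ of isomorphisms $\tau_n:x_n\to\underline{n}$, the functor $F(x,\tau):\widehat{\mathcal{F}\mathcal{S}et}_{sk}\to\mathcal{S}$ defined on objects and morphisms by $$F(x,\tau)[n]=x_n\quad(n\ge0),\qquad F(x,\tau)(\sigma)=\tau_n^{-1}\,F_{can}(\sigma)\,\tau_n\quad(\sigma\in S_n),$$ together with the isomorphisms $$\varphi(\tau)^+_{[m],[n]}=(\tau_m+\tau_n)^{-1}\,\tau_{m+n},\qquad \varphi(\tau)^\bullet_{[m],[n]}=(\tau_m\bullet\tau_n)^{-1}\,\tau_{mn}\qquad(m,n\ge0),$$ and $\varepsilon(\tau)^+=\tau_0$, $\varepsilon(\tau)^\bullet=\tau_1$, is a homomorphism of rig categories $\mathbb{F}(x,\tau):\widehat{\mathbb{F}\mathbb{S}et}_{sk}\to\mathbb{S}$.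
   Context: Composition is written by juxtaposition ($gf$ means $f$ followed by $g$); $xy$ abbreviates $x\bullet y$ on objects. **Rig category.** A rig category $\mathbb{S}$ is a category $\mathcal{S}$ with a symmetric monoidal structure $(+,0,a,c,l,r)$, $a_{x,y,z}:x+(y+z)\to(x+y)+z$, a second monoidal structure $(\bullet,1,a',l',r')$, $a'_{x,y,z}:x(yz)\to(xy)z$, and natural isomorphisms $d_{x,y,z}:x(y+z)\to xy+xz$, $d'_{x,y,z}:(x+y)z\to xz+yz$, $n_x:x0\to0$, $n'_x:0x\to0$ such that for all objects $x,y,z,t$: (1) $(d_{x,y,z}+id_{xt})\,d_{x,y+z,t}\,(id_x\bullet a_{y,z,t})=a_{xy,xz,xt}\,(id_{xy}+d_{x,z,t})\,d_{x,y,z+t}$ and $(d'_{x,y,t}+id_{zt})\,d'_{x+y,z,t}\,(a_{x,y,z}\bullet id_t)=a_{xt,yt,zt}\,(id_{xt}+d'_{y,z,t})\,d'_{x,y+z,t}$; (2) $d_{x,z,y}(id_x\bullet c_{y,z})=c_{xy,xz}d_{x,y,z}$ and $d'_{z,y,x}(c_{y,z}\bullet id_x)=c_{yx,zx}d'_{y,z,x}$; (3) $l_{xy}(n_x+id_{xy})d_{x,0,y}=id_x\bullet l_y$ and $l_{xy}(n'_y+id_{xy})d'_{0,x,y}=l_x\bullet id_y$; (4) $r_{xy}(id_{xy}+n_x)d_{x,y,0}=id_x\bullet r_y$ and $r_{xy}(id_{xy}+n'_y)d'_{x,0,y}=r_x\bullet id_y$; (5) $(a'_{x,z,y}+a'_{x,t,y})d_{x,zy,ty}(id_x\bullet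 d'_{z,t,y})=d'_{xz,xt,y}(d_{x,z,t}\bullet id_y)a'_{x,z+t,y}$ and $n'_y(n_x\bullet id_y)a'_{x,0,y}=n_x(id_x\bullet n'_y)$; (6) $(a'_{x,y,z}+a'_{x,y,t})d_{x,yz,yt}(id_x\bullet d_{y,z,t})=d_{xy,z,t}a'_{x,y,z+t}$, $n_{xy}a'_{x,y,0}=n_x(id_x\bullet n_y)$, $d'_{ty,zy,x}(d'_{t,z,y}\bullet id_x)a'_{t+z,y,x}=(a'_{t,y,x}+a'_{z,y,x})d'_{t,z,yx}$, $n'_x(n'_y\bullet id_x)a'_{0,y,x}=n'_{yx}$; (7) $v_{xz,xt,yz,yt}(d_{x,z,t}+d_{y,z,t})d'_{x,y,z+t}=(d'_{x,y,z}+d'_{x,y,t})d_{x+y,z,t}$, where $v_{p,q,s,u}:(p+q)+(s+u)\to(p+s)+(q+u)$ is the canonical isomorphism built from $a$ and $c$; $l_0(n_x+n_y)d'_{x,y,0}=n_{x+y}$; $l_0(n'_x+n'_y)d_{0,x,y}=n'_{x+y}$; (8) $(l'_x+l'_y)d_{1,x,y}=l'_{x+y}$, $(r'_x+r'_y)d'_{x,y,1}=r'_{x+y}$, $n_1=l'_0$, $n'_1=r'_0$; (9) $n_0=n'_0$. It is left semistrict if all structural isomorphisms except possibly $c$ and $d'$ are identities. **Homomorphism.** A homomorphism of rig categories $\mathbb{F}=(F,\varphi^+,\varepsilon^+,\varphi^\bullet,\varepsilon^\bullet):\mathbb{S}\to\tilde{\mathbb{S}}$ is a functor $F:\mathcal{S}\to\tilde{\mathcal{S}}$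 with natural isomorphisms $\varphi^+_{x,y}:F(x+y)\to Fx+Fy$ and an isomorphism $\varepsilon^+:F0\to\tilde0$ making $F$ a (strong) symmetric monoidal functor for the additive structures, and natural isomorphisms $\varphi^\bullet_{x,y}:F(xy)\to Fx\,Fy$ and an isomorphism $\varepsilon^\bullet:F1\to\tilde1$ making $F$ a (strong) monoidal functor for the multiplicative structures, such that for all $x,y,z$: $(\varphi^\bullet_{x,y}+\varphi^\bullet_{x,z})\varphi^+_{xy,xz}F(d_{x,y,z})=\tilde d_{Fx,Fy,Fz}(id_{Fx}\bullet\varphi^+_{y,z})\varphi^\bullet_{x,y+z}$; $(\varphi^\bullet_{y,x}+\varphi^\bullet_{z,x})\varphi^+_{yx,zx}F(d'_{y,z,x})=\tilde d'_{Fy,Fz,Fx}(\varphi^+_{y,z}\bullet id_{Fx})\varphi^\bullet_{y+z,x}$; $\varepsilon^+F(n_x)=\tilde n_{Fx}(id_{Fx}\bullet\varepsilon^+)\varphi^\bullet_{x,0}$; $\varepsilon^+F(n'_x)=\tilde n'_{Fx}(\varepsilon^+\bullet id_{Fx})\varphi^\bullet_{0,x}$. **The left semistrict 2-rig $\widehat{\mathbb{F}\mathbb{S}et}_{sk}$.** Its underlying groupoid $\widehat{\mathcal{F}\mathcal{S}et}_{sk}$ has objects $[n]=\{1,\dots,n\}$, $n\ge0$ ($[0]=\emptyset$), and morphisms the bijections, so $Aut([n])=S_n$. On objects $[m]+[n]=[m+n]$, $[m]\bullet[n]=[mn]$; zero object $[0]$, unit object $[1]$. For $f\in S_m$, $g\in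 S_n$: $(f+g)(k)=f(k)$ if $k\le m$, $(f+g)(m+k)=m+g(k)$ if $1\le k\le n$; $(f\bullet g)((j-1)m+i)=(g(j)-1)m+f(i)$ for $1\le i\le m$, $1\le j\le n$. The additive commutator is $c_{[m],[n]}(k)=n+k$ for $k\le m$, $c_{[m],[n]}(k)=k-m$ for $m<k\le m+n$. The right distributor $d'_{[m],[n],[p]}$ is the inverse of the permutation $\overline d'$ of $[(m+n)p]$ given by $\overline d'((j-1)m+i)=(j-1)(m+n)+i$ ($1\le i\le m$, $1\le j\le p$) and $\overline d'(mp+(j-1)n+i)=(j-1)(m+n)+m+i$ ($1\le i\le n$, $1\le j\le p$). All other structural isomorphisms ($a,l,r,a',l',r',d,n,n'$) are identities. **Notation in $\mathbb{S}$.** $\underline{n}=1+\cdots+1$ ($n$ summands of the unit object $1$ of $\mathbb{S}$), $\underline{0}=0$. $F_{can}:\widehat{\mathcal{F}\mathcal{S}et}_{sk}\to\mathcal{S}$ is the functor with $F_{can}[n]=\underline{n}$ and, on the generating adjacent transpositions $(i,i+1)_n\in S_n$, $n\ge2$, $F_{can}((i,i+1)_n)=id_{\underline{i-1}}+c_{\underline1,\underline1}+id_{\underline{n-i-1}}$. *)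

(* Defs.v *)
From mathcomp Require Import all_boot all_fingroup boolp zify.

Set Implicit Arguments.
Unset Strict Implicit.
Unset Printing Implicit Defensive.

Record category := Category {
  ob :> Type;
  hom : ob -> ob -> Type;
  idm : forall x, hom x x;
  comp : forall x y z, hom y z -> hom x y -> hom x z;
  comp1m : forall x y (f : hom x y), comp (idm y) f = f;
  compm1 : forall x y (f : hom x y), comp f (idm x) = f;
  compA : forall x y z t (h : hom z t) (g : hom y z) (f : hom x y),
    comp h (comp g f) = comp (comp h g) f }.

Arguments hom {c} x y.
Arguments idm {c} x.
Arguments comp {c x y z} g f.

Notation "g ∘ f" := (comp g f) (at level 40, left associativity).

Record iso (C : category) (x y : C) := Iso {
  iso_hom :> hom x y;
  iso_inv : hom y x;
  iso_invK : iso_inv ∘ iso_hom = idm x;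
  iso_homK : iso_hom ∘ iso_inv = idm y }.

Definition is_iso (C : category) (x y : C) (f : hom x y) : Prop :=
  exists g : hom y x, g ∘ f = idm x /\ f ∘ g = idm y.

Definition isomorphic (C : category) (x y : C) : Prop := inhabited (iso x y).

(* Propositionally equal objects need not be convertible; [eq_hom e] is the
   identity morphism read along such an equation. *)
Definition eq_hom (C : category) (x y : C) (e : x = y) : hom x y :=
  match e in _ = y return hom x y with erefl => idm x end.

(* "f is an identity morphism": in particular its source and its target are
   the same object. *)
Inductive is_identity (C : category) : forall x y : C, hom x y -> Prop :=
  IsIdentity (x : C) : is_identity (idm x).

Record is_functor (C D : category) (F0 : C -> D)
    (F1 : forall x y : C, hom x y -> hom (F0 x) (F0 y)) : Prop := IsFunctor {
  functor_id : forall x, F1 x x (idm x) = idm (F0 x);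
  functor_comp : forall x y z (g : hom y z) (f : hom x y),
    F1 x z (g ∘ f) = F1 y z g ∘ F1 x y f }.

Record monoidal (C : category) := Monoidal {
  tens : C -> C -> C;
  tensm : forall x x' y y', hom x x' -> hom y y' -> hom (tens x y) (tens x' y');
  tens_unit : C;
  tensm1 : forall x y, tensm (idm x) (idm y) = idm (tens x y);
  tensm_comp : forall x x' x'' y y' y''
      (g : hom x' x'') (f : hom x x') (k : hom y' y'') (h : hom y y'),
    tensm (g ∘ f) (k ∘ h) = tensm g k ∘ tensm f h;
  assoc : forall x y z, iso (tens x (tens y z)) (tens (tens x y) z);
  lunit : forall x, iso (tens tens_unit x) x;
  runit : forall x, iso (tens x tens_unit) x;
  assoc_nat : forall x x' y y' z z' (f : hom x x') (g : hom y y') (h : hom z z'),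
    assoc x' y' z' ∘ tensm f (tensm g h) = tensm (tensm f g) h ∘ assoc x y z;
  lunit_nat : forall x x' (f : hom x x'),
    lunit x' ∘ tensm (idm tens_unit) f = f ∘ lunit x;
  runit_nat : forall x x' (f : hom x x'),
    runit x' ∘ tensm f (idm tens_unit) = f ∘ runit x;
  pentagon : forall x y z t,
    tensm (assoc x y z) (idm t) ∘ assoc x (tens y z) t ∘ tensm (idm x) (assoc y z t)
    = assoc (tens x y) z t ∘ assoc x y (tens z t);
  triangle : forall x y,
    tensm (runit x) (idm y) ∘ assoc x tens_unit y = tensm (idm x) (lunit y) }.

Record symmetric_monoidal (C : category) := SymmetricMonoidal {
  symm_monoidal :> monoidal C;
  braid : forall x y, iso (tens symm_monoidal x y) (tens symm_monoidal y x);
  braid_nat : forall x x' y y' (f : hom x x') (g : hom y y'),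
    braid x' y' ∘ tensm symm_monoidal f g = tensm symm_monoidal g f ∘ braid x y;
  braidK : forall x y, braid y x ∘ braid x y = idm (tens symm_monoidal x y);
  hexagon : forall x y z,
    assoc symm_monoidal z x y ∘ braid (tens symm_monoidal x y) z
      ∘ assoc symm_monoidal x y z
    = tensm symm_monoidal (braid x z) (idm y) ∘ assoc symm_monoidal x z y
      ∘ tensm symm_monoidal (idm x) (braid y z);
  braid_unit : forall x,
    lunit symm_monoidal x ∘ braid x (tens_unit symm_monoidal)
    = runit symm_monoidal x }.

Record rig_data := RigData {
  rig_cat :> category;
  rig_add : symmetric_monoidal rig_cat;
  rig_mul : monoidal rig_cat;
  ldistr : forall x y z, iso (tens rig_mul x (tens rig_add y z))
                             (tens rig_add (tens rig_mul x y) (tens rig_mul x z));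
  rdistr : forall x y z, iso (tens rig_mul (tens rig_add x y) z)
                             (tens rig_add (tens rig_mul x z) (tens rig_mul y z));
  rnull : forall x, iso (tens rig_mul x (tens_unit rig_add)) (tens_unit rig_add);
  lnull : forall x, iso (tens rig_mul (tens_unit rig_add) x) (tens_unit rig_add) }.

Notation "x ⊕ y" := (tens (rig_add _) x y) (at level 50, left associativity).
Notation "x ⊗ y" := (tens (rig_mul _) x y) (at level 37, left associativity).
Notation "f ⊞ g" := (tensm (rig_add _) f g) (at level 38, left associativity).
Notation "f ⊠ g" := (tensm (rig_mul _) f g) (at level 37, left associativity).

Definition rig0 {S : rig_data} : S := tens_unit (rig_add S).
Definition rig1 {S : rig_data} : S := tens_unit (rig_mul S).

Notation "'a_[' x , y , z ]" := (assoc (rig_add _) x y z).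
Notation "'a^-1_[' x , y , z ]" := (iso_inv (assoc (rig_add _) x y z)).
Notation "'l_[' x ]" := (lunit (rig_add _) x).
Notation "'r_[' x ]" := (runit (rig_add _) x).
Notation "'c_[' x , y ]" := (braid (rig_add _) x y).
Notation "'a′_[' x , y , z ]" := (assoc (rig_mul _) x y z).
Notation "'l′_[' x ]" := (lunit (rig_mul _) x).
Notation "'r′_[' x ]" := (runit (rig_mul _) x).
Notation "'d_[' x , y , z ]" := (ldistr x y z).
Notation "'d′_[' x , y , z ]" := (rdistr x y z).
Notation "'n_[' x ]" := (rnull x).
Notation "'n′_[' x ]" := (lnull x).

(* The canonical (p + q) + (s + u) -> (p + s) + (q + u); by coherence the
   chosen path does not matter. *)
Definition interchange {S : rig_data} (p q s u : S) :
    hom ((p ⊕ q) ⊕ (s ⊕ u)) ((p ⊕ s) ⊕ (q ⊕ u)) :=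
  a^-1_[p ⊕ s, q, u] ∘ (a_[p, s, q] ⊞ idm u) ∘ ((idm p ⊞ c_[q, s]) ⊞ idm u)
    ∘ (a^-1_[p, q, s] ⊞ idm u) ∘ a_[p ⊕ q, s, u].

Record rig_laws (S : rig_data) : Prop := RigLaws {
  ldistr_nat : forall (x x' y y' z z' : S) (f : hom x x') (g : hom y y') (h : hom z z'),
    d_[x', y', z'] ∘ (f ⊠ (g ⊞ h)) = ((f ⊠ g) ⊞ (f ⊠ h)) ∘ d_[x, y, z];
  rdistr_nat : forall (x x' y y' z z' : S) (f : hom x x') (g : hom y y') (h : hom z z'),
    d′_[x', y', z'] ∘ ((f ⊞ g) ⊠ h) = ((f ⊠ h) ⊞ (g ⊠ h)) ∘ d′_[x, y, z];
  rnull_nat : forall (x x' : S) (f : hom x x'),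
    n_[x'] ∘ (f ⊠ idm rig0) = n_[x];
  lnull_nat : forall (x x' : S) (f : hom x x'),
    n′_[x'] ∘ (idm rig0 ⊠ f) = n′_[x];
  ldistr_assoc : forall x y z t : S,
    (d_[x, y, z] ⊞ idm (x ⊗ t)) ∘ d_[x, y ⊕ z, t] ∘ (idm x ⊠ a_[y, z, t])
    = a_[x ⊗ y, x ⊗ z, x ⊗ t] ∘ (idm (x ⊗ y) ⊞ d_[x, z, t]) ∘ d_[x, y, z ⊕ t];
  rdistr_assoc : forall x y z t : S,
    (d′_[x, y, t] ⊞ idm (z ⊗ t)) ∘ d′_[x ⊕ y, z, t] ∘ (a_[x, y, z] ⊠ idm t)
    = a_[x ⊗ t, y ⊗ t, z ⊗ t] ∘ (idm (x ⊗ t) ⊞ d′_[y, z, t]) ∘ d′_[x, y ⊕ z, t];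
  ldistr_braid : forall x y z : S,
    d_[x, z, y] ∘ (idm x ⊠ c_[y, z]) = c_[x ⊗ y, x ⊗ z] ∘ d_[x, y, z];
  rdistr_braid : forall x y z : S,
    d′_[z, y, x] ∘ (c_[y, z] ⊠ idm x) = c_[y ⊗ x, z ⊗ x] ∘ d′_[y, z, x];
  ldistr_lunit : forall x y : S,
    l_[x ⊗ y] ∘ (n_[x] ⊞ idm (x ⊗ y)) ∘ d_[x, rig0, y] = idm x ⊠ l_[y];
  rdistr_lunit : forall x y : S,
    l_[x ⊗ y] ∘ (n′_[y] ⊞ idm (x ⊗ y)) ∘ d′_[rig0, x, y] = l_[x] ⊠ idm y;
  ldistr_runit : forall x y : S,
    r_[x ⊗ y] ∘ (idm (x ⊗ y) ⊞ n_[x]) ∘ d_[x, y, rig0] = idm x ⊠ r_[y];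
  rdistr_runit : forall x y : S,
    r_[x ⊗ y] ∘ (idm (x ⊗ y) ⊞ n′_[y]) ∘ d′_[x, rig0, y] = r_[x] ⊠ idm y;
  lrdistr_mul : forall x y z t : S,
    (a′_[x, z, y] ⊞ a′_[x, t, y]) ∘ d_[x, z ⊗ y, t ⊗ y] ∘ (idm x ⊠ d′_[z, t, y])
    = d′_[x ⊗ z, x ⊗ t, y] ∘ (d_[x, z, t] ⊠ idm y) ∘ a′_[x, z ⊕ t, y];
  lrnull_mul : forall x y : S,
    n′_[y] ∘ (n_[x] ⊠ idm y) ∘ a′_[x, rig0, y] = n_[x] ∘ (idm x ⊠ n′_[y]);
  ldistr_mul : forall x y z t : S,
    (a′_[x, y, z] ⊞ a′_[x, y, t]) ∘ d_[x, y ⊗ z, y ⊗ t] ∘ (idm x ⊠ d_[y, z, t])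
    = d_[x ⊗ y, z, t] ∘ a′_[x, y, z ⊕ t];
  rnull_mul : forall x y : S,
    n_[x ⊗ y] ∘ a′_[x, y, rig0] = n_[x] ∘ (idm x ⊠ n_[y]);
  rdistr_mul : forall x y z t : S,
    d′_[t ⊗ y, z ⊗ y, x] ∘ (d′_[t, z, y] ⊠ idm x) ∘ a′_[t ⊕ z, y, x]
    = (a′_[t, y, x] ⊞ a′_[z, y, x]) ∘ d′_[t, z, y ⊗ x];
  lnull_mul : forall x y : S,
    n′_[x] ∘ (n′_[y] ⊠ idm x) ∘ a′_[rig0, y, x] = n′_[y ⊗ x];
  lrdistr_add : forall x y z t : S,
    interchange (x ⊗ z) (x ⊗ t) (y ⊗ z) (y ⊗ t)
      ∘ (d_[x, z, t] ⊞ d_[y, z, t]) ∘ d′_[x, y, z ⊕ t]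
    = (d′_[x, y, z] ⊞ d′_[x, y, t]) ∘ d_[x ⊕ y, z, t];
  rnull_add : forall x y : S,
    l_[rig0] ∘ (n_[x] ⊞ n_[y]) ∘ d′_[x, y, rig0] = n_[x ⊕ y];
  lnull_add : forall x y : S,
    l_[rig0] ∘ (n′_[x] ⊞ n′_[y]) ∘ d_[rig0, x, y] = n′_[x ⊕ y];
  ldistr_rig1 : forall x y : S,
    (l′_[x] ⊞ l′_[y]) ∘ d_[rig1, x, y] = l′_[x ⊕ y];
  rdistr_rig1 : forall x y : S,
    (r′_[x] ⊞ r′_[y]) ∘ d′_[x, y, rig1] = r′_[x ⊕ y];
  rnull_rig1 : n_[rig1] = l′_[rig0] :> hom (rig1 ⊗ rig0) (rig0 : S);
  lnull_rig1 : n′_[rig1] = r′_[rig0] :> hom (rig0 ⊗ rig1) (rig0 : S);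
  rnull_rig0 : n_[rig0] = n′_[rig0] :> hom (rig0 ⊗ rig0) (rig0 : S) }.

Record rig_category := RigCategory {
  rig_category_data :> rig_data;
  rig_categoryP : rig_laws rig_category_data }.

Record left_semistrict (S : rig_data) : Prop := LeftSemistrict {
  strict_a : forall x y z : S, is_identity a_[x, y, z];
  strict_l : forall x : S, is_identity l_[x];
  strict_r : forall x : S, is_identity r_[x];
  strict_a' : forall x y z : S, is_identity a′_[x, y, z];
  strict_l' : forall x : S, is_identity l′_[x];
  strict_r' : forall x : S, is_identity r′_[x];
  strict_d : forall x y z : S, is_identity d_[x, y, z];
  strict_n : forall x : S, is_identity n_[x];
  strict_n' : forall x : S, is_identity n′_[x] }.

Record is_rig_homomorphism (S T : rig_category) (F0 : S -> T)
    (F1 : forall x y : S, hom x y -> hom (F0 x) (F0 y))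
    (phiA : forall x y : S, hom (F0 (x ⊕ y)) (F0 x ⊕ F0 y))
    (epsA : hom (F0 rig0) rig0)
    (phiM : forall x y : S, hom (F0 (x ⊗ y)) (F0 x ⊗ F0 y))
    (epsM : hom (F0 rig1) rig1) : Prop := IsRigHomomorphism {
  rhom_functor : is_functor F1;
  rhom_phiA_iso : forall x y, is_iso (phiA x y);
  rhom_epsA_iso : is_iso epsA;
  rhom_phiA_nat : forall x x' y y' (f : hom x x') (g : hom y y'),
    phiA x' y' ∘ F1 _ _ (f ⊞ g) = (F1 _ _ f ⊞ F1 _ _ g) ∘ phiA x y;
  rhom_phiA_assoc : forall x y z,
    (phiA x y ⊞ idm (F0 z)) ∘ phiA (x ⊕ y) z ∘ F1 _ _ a_[x, y, z]
    = a_[F0 x, F0 y, F0 z] ∘ (idm (F0 x) ⊞ phiA y z) ∘ phiA x (y ⊕ z);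
  rhom_phiA_lunit : forall x,
    l_[F0 x] ∘ (epsA ⊞ idm (F0 x)) ∘ phiA rig0 x = F1 _ _ l_[x];
  rhom_phiA_runit : forall x,
    r_[F0 x] ∘ (idm (F0 x) ⊞ epsA) ∘ phiA x rig0 = F1 _ _ r_[x];
  rhom_phiA_braid : forall x y,
    phiA y x ∘ F1 _ _ c_[x, y] = c_[F0 x, F0 y] ∘ phiA x y;
  rhom_phiM_iso : forall x y, is_iso (phiM x y);
  rhom_epsM_iso : is_iso epsM;
  rhom_phiM_nat : forall x x' y y' (f : hom x x') (g : hom y y'),
    phiM x' y' ∘ F1 _ _ (f ⊠ g) = (F1 _ _ f ⊠ F1 _ _ g) ∘ phiM x y;
  rhom_phiM_assoc : forall x y z,
    (phiM x y ⊠ idm (F0 z)) ∘ phiM (x ⊗ y) z ∘ F1 _ _ a′_[x, y, z]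
    = a′_[F0 x, F0 y, F0 z] ∘ (idm (F0 x) ⊠ phiM y z) ∘ phiM x (y ⊗ z);
  rhom_phiM_lunit : forall x,
    l′_[F0 x] ∘ (epsM ⊠ idm (F0 x)) ∘ phiM rig1 x = F1 _ _ l′_[x];
  rhom_phiM_runit : forall x,
    r′_[F0 x] ∘ (idm (F0 x) ⊠ epsM) ∘ phiM x rig1 = F1 _ _ r′_[x];
  rhom_ldistr : forall x y z,
    (phiM x y ⊞ phiM x z) ∘ phiA (x ⊗ y) (x ⊗ z) ∘ F1 _ _ d_[x, y, z]
    = d_[F0 x, F0 y, F0 z] ∘ (idm (F0 x) ⊠ phiA y z) ∘ phiM x (y ⊕ z);
  rhom_rdistr : forall x y z,
    (phiM y x ⊞ phiM z x) ∘ phiA (y ⊗ x) (z ⊗ x) ∘ F1 _ _ d′_[y, z, x]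
    = d′_[F0 y, F0 z, F0 x] ∘ (phiA y z ⊠ idm (F0 x)) ∘ phiM (y ⊕ z) x;
  rhom_rnull : forall x,
    epsA ∘ F1 _ _ n_[x] = n_[F0 x] ∘ (idm (F0 x) ⊠ epsA) ∘ phiM x rig0;
  rhom_lnull : forall x,
    epsA ∘ F1 _ _ n′_[x] = n′_[F0 x] ∘ (epsA ⊠ idm (F0 x)) ∘ phiM rig0 x }.

Record bij (m n : nat) := Bij {
  bij_fun :> 'I_m -> 'I_n;
  bij_inv : 'I_n -> 'I_m;
  bij_funK : cancel bij_fun bij_inv;
  bij_invK : cancel bij_inv bij_fun }.

Lemma bij_ext (m n : nat) (f g : bij m n) : f =1 g -> f = g.
Proof.
case: f g => [f f' fK f'K] [g g' gK g'K] /= efg.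
have {}efg : f = g by apply: funext.
subst g.
have efg' : f' = g' by apply: funext => i; rewrite -[in LHS](g'K i) fK.
by subst g'; congr Bij; apply: Prop_irrelevance.
Qed.

Definition bij_id (n : nat) : bij n n := @Bij n n id id (frefl _) (frefl _).

Definition bij_comp (m n p : nat) (g : bij n p) (f : bij m n) : bij m p :=
  Bij (can_comp (bij_funK g) (bij_funK f)) (can_comp (bij_invK f) (bij_invK g)).

Definition bij_sym (m n : nat) (f : bij m n) : bij n m :=
  Bij (bij_invK f) (bij_funK f).

Definition bij_cast (m n : nat) (e : m = n) : bij m n :=
  Bij (cast_ordK e) (cast_ordKV e).

Definition bij_perm (n : nat) (s : {perm 'I_n}) : bij n n :=
  Bij (permK s) (permKV s).

Lemma mul_idx_subproof (m n : nat) (i : 'I_m) (j : 'I_n) : j * m + i < m * n.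
Proof. case: i j => i hi [j hj] /=; nia. Qed.

Lemma row_subproof (m n : nat) (k : 'I_(m * n)) : k %% m < m.
Proof. by case: m k => [[]|m k] //; rewrite ltn_mod. Qed.

Lemma col_subproof (m n : nat) (k : 'I_(m * n)) : k %/ m < n.
Proof.
case: m k => [[]|m k] //; rewrite ltn_divLR // [n * _]mulnC; exact: ltn_ord.
Qed.

(* The position in [m][n] of the i-th element of the j-th block; counting from
   0 instead of from 1, it is jm + i. *)
Definition mul_idx (m n : nat) (i : 'I_m) (j : 'I_n) : 'I_(m * n) :=
  Ordinal (mul_idx_subproof i j).
Definition mul_row (m n : nat) (k : 'I_(m * n)) : 'I_m := Ordinal (row_subproof k).
Definition mul_col (m n : nat) (k : 'I_(m * n)) : 'I_n := Ordinal (col_subproof k).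

Lemma mul_idx_row (m n : nat) (i : 'I_m) (j : 'I_n) : mul_row (mul_idx i j) = i.
Proof. by apply: val_inj => /=; rewrite modnMDl modn_small. Qed.

Lemma mul_idx_col (m n : nat) (i : 'I_m) (j : 'I_n) : mul_col (mul_idx i j) = j.
Proof.
apply: val_inj => /=; have m_gt0 : 0 < m by case: i => i; case: (m).
by rewrite divnMDl // divn_small // addn0.
Qed.

Lemma mul_idxK (m n : nat) (k : 'I_(m * n)) : mul_idx (mul_row k) (mul_col k) = k.
Proof. by apply: val_inj => /=; rewrite -divn_eq. Qed.

Definition bij_add_fun (m m' n n' : nat) (f : 'I_m -> 'I_m') (g : 'I_n -> 'I_n')
    (k : 'I_(m + n)) : 'I_(m' + n') :=
  match split k with inl i => lshift n' (f i) | inr j => rshift m' (g j) end.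

Definition bij_mul_fun (m m' n n' : nat) (f : 'I_m -> 'I_m') (g : 'I_n -> 'I_n')
    (k : 'I_(m * n)) : 'I_(m' * n') :=
  mul_idx (f (mul_row k)) (g (mul_col k)).

Definition braid_fun (m n : nat) (k : 'I_(m + n)) : 'I_(n + m) :=
  match split k with inl i => rshift n i | inr j => lshift m j end.

(* For 'I_((m + n) * p), the i-th element of the j-th block, of size m + n, is
   at j(m + n) + i; the right distributor is the inverse of this bijection. *)
Definition dbar_fun (m n p : nat) (k : 'I_(m * p + n * p)) : 'I_((m + n) * p) :=
  match split k with
  | inl k => mul_idx (lshift n (mul_row k)) (mul_col k)
  | inr k => mul_idx (rshift m (mul_row k)) (mul_col k)
  end.

Definition dbar_inv (m n p : nat) (k : 'I_((m + n) * p)) : 'I_(m * p + n * p) :=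
  match split (mul_row k) with
  | inl i => lshift (n * p) (mul_idx i (mul_col k))
  | inr i => rshift (m * p) (mul_idx i (mul_col k))
  end.

Lemma split_lshift (m n : nat) (i : 'I_m) : split (lshift n i) = inl i.
Proof. exact: (unsplitK (inl i)). Qed.

Lemma split_rshift (m n : nat) (j : 'I_n) : split (rshift m j) = inr j.
Proof. exact: (unsplitK (inr j)). Qed.

Lemma add_idxP (m n : nat) (k : 'I_(m + n)) :
  (exists i, k = lshift n i) \/ (exists j, k = rshift m j).
Proof.
by rewrite -(splitK k); case: (split k) => i; [left|right]; exists i.
Qed.

Lemma mul_idxP (m n : nat) (k : 'I_(m * n)) : exists i j, k = mul_idx i j.
Proof. by exists (mul_row k), (mul_col k); rewrite mul_idxK. Qed.

Definition idxE := (split_lshift, split_rshift, mul_idx_row, mul_idx_col).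

Ltac split_idx :=
  repeat match goal with
  | k : 'I_(addn _ _) |- _ => destruct (add_idxP k) as [[? ?]|[? ?]]; subst k
  | k : 'I_(muln _ _) |- _ => destruct (mul_idxP k) as [? [? ?]]; subst k
  | k : 'I_0 |- _ => destruct k; discriminate
  end.

Lemma bij_add_funK (m m' n n' : nat) (f : bij m m') (g : bij n n') :
  cancel (bij_add_fun f g) (bij_add_fun (bij_inv f) (bij_inv g)).
Proof. by move=> k; split_idx; rewrite /bij_add_fun !idxE bij_funK. Qed.

Lemma bij_mul_funK (m m' n n' : nat) (f : bij m m') (g : bij n n') :
  cancel (bij_mul_fun f g) (bij_mul_fun (bij_inv f) (bij_inv g)).
Proof. by move=> k; split_idx; rewrite /bij_mul_fun !idxE !bij_funK. Qed.

Lemma braid_funK (m n : nat) : cancel (@braid_fun m n) (@braid_fun n m).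
Proof. by move=> k; split_idx; rewrite /braid_fun !idxE. Qed.

Lemma dbar_funK (m n p : nat) : cancel (@dbar_fun m n p) (@dbar_inv m n p).
Proof. by move=> k; split_idx; rewrite /dbar_fun /dbar_inv !idxE. Qed.

Lemma dbar_invK (m n p : nat) : cancel (@dbar_inv m n p) (@dbar_fun m n p).
Proof. by move=> k; split_idx; rewrite /dbar_fun /dbar_inv !idxE. Qed.

Definition bij_add (m m' n n' : nat) (f : bij m m') (g : bij n n') :
    bij (m + n) (m' + n') :=
  Bij (bij_add_funK f g) (bij_add_funK (bij_sym f) (bij_sym g)).

Definition bij_mul (m m' n n' : nat) (f : bij m m') (g : bij n n') :
    bij (m * n) (m' * n') :=
  Bij (bij_mul_funK f g) (bij_mul_funK (bij_sym f) (bij_sym g)).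

Definition bij_braid (m n : nat) : bij (m + n) (n + m) :=
  Bij (@braid_funK m n) (@braid_funK n m).

Definition bij_dbar (m n p : nat) : bij (m * p + n * p) ((m + n) * p) :=
  Bij (@dbar_funK m n p) (@dbar_invK m n p).

Definition FSet_cat : category.
Proof.
by refine (@Category nat bij bij_id bij_comp _ _ _) => *; apply: bij_ext.
Defined.

Lemma bij_symK (m n : nat) (f : bij m n) : bij_comp (bij_sym f) f = bij_id m.
Proof. by apply: bij_ext => i; apply: bij_funK. Qed.

Lemma bij_symKV (m n : nat) (f : bij m n) : bij_comp f (bij_sym f) = bij_id n.
Proof. by apply: bij_ext => i; apply: bij_invK. Qed.

Definition bij_iso (m n : FSet_cat) (f : bij m n) : iso m n :=
  @Iso FSet_cat m n f (bij_sym f) (bij_symK f) (bij_symKV f).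

Lemma cast_l (n : nat) (e : 0 + n = n) (i : 'I_n) : cast_ord e (rshift 0 i) = i.
Proof. exact: val_inj. Qed.

Lemma cast_r (n : nat) (e : n + 0 = n) (i : 'I_n) : cast_ord e (lshift 0 i) = i.
Proof. exact: val_inj. Qed.

Lemma cast_a (m n p : nat) (e : m + (n + p) = m + n + p) :
  (forall i, cast_ord e (lshift (n + p) i) = lshift p (lshift n i)) *
  (forall i, cast_ord e (rshift m (lshift p i)) = lshift p (rshift m i)) *
  (forall i, cast_ord e (rshift m (rshift n i)) = rshift (m + n) i).
Proof. by do ![split] => i; apply: val_inj => //=; rewrite addnA. Qed.

Lemma cast_aV (m n p : nat) (e : m + n + p = m + (n + p)) :
  (forall i, cast_ord e (lshift p (lshift n i)) = lshift (n + p) i) *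
  (forall i, cast_ord e (lshift p (rshift m i)) = rshift m (lshift p i)) *
  (forall i, cast_ord e (rshift (m + n) i) = rshift m (rshift n i)).
Proof. by do ![split] => i; apply: val_inj => //=; rewrite addnA. Qed.

Lemma cast_l' (n : nat) (e : 1 * n = n) (i : 'I_1) (j : 'I_n) :
  cast_ord e (mul_idx i j) = j.
Proof. by apply: val_inj => /=; rewrite ord1 muln1 addn0. Qed.

Lemma cast_r' (n : nat) (e : n * 1 = n) (i : 'I_n) (j : 'I_1) :
  cast_ord e (mul_idx i j) = i.
Proof. by apply: val_inj => /=; rewrite ord1. Qed.

Lemma cast_a' (m n p : nat) (e : m * (n * p) = m * n * p)
    (i : 'I_m) (j : 'I_n) (k : 'I_p) :
  cast_ord e (mul_idx i (mul_idx j k)) = mul_idx (mul_idx i j) k.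
Proof.
by apply: val_inj => /=; rewrite mulnDl -mulnA [n * m]mulnC addnA.
Qed.

Lemma cast_d (m n p : nat) (e : m * (n + p) = m * n + m * p) (i : 'I_m) :
  (forall j, cast_ord e (mul_idx i (lshift p j)) = lshift (m * p) (mul_idx i j)) *
  (forall j, cast_ord e (mul_idx i (rshift n j)) = rshift (m * n) (mul_idx i j)).
Proof.
by split=> j; apply: val_inj => //=; rewrite mulnDl [n * m]mulnC addnA.
Qed.

Definition castE :=
  (cast_l, cast_r, cast_a, cast_aV, cast_l', cast_r', cast_a', cast_d).

Ltac bij_law := intros; apply: bij_ext => ?; unfold rig0, rig1 in *; simpl in *; split_idx;
  repeat progress (
    rewrite /bij_add_fun /bij_mul_fun /braid_fun /dbar_fun /dbar_inv /= ?idxE ?castE).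

Definition FSet_add_monoidal : monoidal FSet_cat.
Proof.
refine (@Monoidal FSet_cat addn bij_add 0 _ _
  (fun m n p => bij_iso (bij_cast (addnA m n p)))
  (fun n => bij_iso (bij_cast (add0n n)))
  (fun n => bij_iso (bij_cast (addn0 n))) _ _ _ _ _).
all: by bij_law.
Defined.

Definition FSet_add : symmetric_monoidal FSet_cat.
Proof.
refine (@SymmetricMonoidal FSet_cat FSet_add_monoidal
  (fun m n => bij_iso (bij_braid m n)) _ _ _ _).
all: by bij_law.
Defined.

Definition FSet_mul : monoidal FSet_cat.
Proof.
refine (@Monoidal FSet_cat muln bij_mul 1 _ _
  (fun m n p => bij_iso (bij_cast (mulnA m n p)))
  (fun n => bij_iso (bij_cast (mul1n n)))
  (fun n => bij_iso (bij_cast (muln1 n))) _ _ _ _ _).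
all: by bij_law.
Defined.

Definition FSet_data : rig_data :=
  @RigData FSet_cat FSet_add FSet_mul
    (fun m n p => bij_iso (bij_cast (mulnDr m n p)))
    (fun m n p => bij_iso (bij_sym (bij_dbar m n p)))
    (fun n => bij_iso (bij_cast (muln0 n)))
    (fun n => bij_iso (bij_cast (mul0n n))).

Lemma FSet_laws : rig_laws FSet_data.
Proof.
constructor.
all: by bij_law.
Qed.

Definition FSet_sk : rig_category := RigCategory FSet_laws.

Lemma bij_cast_is_identity (m n : nat) (e : m = n) :
  is_identity (bij_cast e : @hom FSet_cat m n).
Proof.
case: n / e; have -> : bij_cast (erefl m) = idm (m : FSet_cat).
  by apply: bij_ext => i; apply: cast_ord_id.
exact: IsIdentity.
Qed.

Lemma FSet_left_semistrict : left_semistrict FSet_sk.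
Proof. by split=> *; apply: bij_cast_is_identity. Qed.

Lemma is_identity_eq (C : category) (x y : C) (f : hom x y) :
  is_identity f -> x = y.
Proof. by case. Qed.

Fixpoint underline {S : rig_data} (n : nat) : S :=
  match n with
  | 0 => rig0
  | 1 => rig1
  | n'.+1 => underline n' ⊕ rig1
  end.

Section Strict.

Variables (S : rig_category) (hS : left_semistrict S).

Lemma strict_addA (x y z : S) : x ⊕ (y ⊕ z) = x ⊕ y ⊕ z.
Proof. exact: is_identity_eq (strict_a hS x y z). Qed.

Lemma strict_add0 (x : S) : rig0 ⊕ x = x.
Proof. exact: is_identity_eq (strict_l hS x). Qed.

Lemma strict_addr0 (x : S) : x ⊕ rig0 = x.
Proof. exact: is_identity_eq (strict_r hS x). Qed.

Lemma underlineS (n : nat) : underline n.+1 = underline n ⊕ rig1 :> S.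
Proof. by case: n => [|n] //=; rewrite strict_add0. Qed.

Lemma underline_add (m n : nat) :
  underline (m + n) = underline m ⊕ underline n :> S.
Proof.
elim: n => [|n IHn]; first by rewrite addn0 [underline 0]/= strict_addr0.
by rewrite addnS !underlineS IHn strict_addA.
Qed.

Lemma underline_mul (m n : nat) :
  underline (m * n) = underline m ⊗ underline n :> S.
Proof.
elim: n => [|n IHn].
  by rewrite muln0 (is_identity_eq (strict_n hS (underline m))).
rewrite mulnS addnC underline_add IHn underlineS.
rewrite (is_identity_eq (strict_d hS _ _ _)).
by rewrite (is_identity_eq (strict_r' hS (underline m))).
Qed.

Lemma underline_split (n i : nat) (hi : i.+1 < n) :
  underline n = underline i ⊕ (rig1 ⊕ rig1) ⊕ underline (n - i.+2) :> S.
Proof.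
by rewrite -[in LHS](subnKC hi) -addn2 !underline_add.
Qed.

(* id + c_{1,1} + id on 1 + ... + 1 (n summands), where c_{1,1} acts on the
   summands i and i+1, counting from 0. *)
Definition transp (n i : nat) (hi : i.+1 < n) :
    hom (underline n : S) (underline n) :=
  eq_hom (esym (underline_split hi))
    ∘ (idm (underline i) ⊞ c_[rig1, rig1] ⊞ idm (underline (n - i.+2)))
    ∘ eq_hom (underline_split hi).

(* The object part, n |-> 1 + ... + 1, is in the type of F1. Existence and
   uniqueness are [Fcan_exists] and [Fcan_unique] below. *)
Definition is_Fcan
    (F1 : forall m n : FSet_sk, hom m n -> hom (underline m : S) (underline n)) :
    Prop :=
  is_functor F1 /\
  forall (n i : nat) (hi : i.+1 < n),
    F1 n n (bij_perm (tperm (Ordinal (ltnW hi)) (Ordinal hi))) = transp hi.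

(* Two morphisms with the same underlying [arrow] are equal up to composition
   with identities along equations between objects. *)
Record arrow := Arrow { src : S; tgt : S; mor : hom src tgt }.
Arguments Arrow {src tgt} mor.

Lemma arr_inj (x y : S) (f g : hom x y) : Arrow f = Arrow g -> f = g.
Proof.
have gen A B : A = B -> exists (ex : src A = src B) (ey : tgt A = tgt B),
    eq_hom ey ∘ mor A = mor B ∘ eq_hom ex.
  by case: B /; exists erefl, erefl; rewrite /= comp1m compm1.
move=> /gen [/= ex [ey]].
by rewrite (Prop_irrelevance ex erefl) (Prop_irrelevance ey erefl) /= comp1m compm1.
Qed.

Lemma arr_comp (x y z x' y' z' : S) (f : hom x y) (g : hom y z)
    (f' : hom x' y') (g' : hom y' z') :
  Arrow g = Arrow g' -> Arrow f = Arrow f' -> Arrow (g ∘ f) = Arrow (g' ∘ f').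
Proof.
move=> eg ef.
have ey : y = y' := congr1 tgt ef.
have ez : z = z' := congr1 tgt eg.
have ex : x = x' := congr1 src ef.
by subst x' y' z'; rewrite (arr_inj eg) (arr_inj ef).
Qed.

Lemma arr_identity (x y : S) (f : hom x y) : is_identity f -> Arrow f = Arrow (idm x).
Proof. by case. Qed.

Lemma arr_eq_hom (x y : S) (e : x = y) : Arrow (eq_hom e) = Arrow (idm x).
Proof. by case: y / e. Qed.

Lemma arr_compl (x y z : S) (f : hom x y) (g : hom y z) :
  Arrow g = Arrow (idm y) -> Arrow (g ∘ f) = Arrow f.
Proof. by move=> /arr_comp/(_ erefl) ->; rewrite comp1m. Qed.

Lemma arr_compr (x y z : S) (f : hom x y) (g : hom y z) :
  Arrow f = Arrow (idm y) -> Arrow (g ∘ f) = Arrow g.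
Proof. by move=> /(arr_comp erefl) ->; rewrite compm1. Qed.

Lemma arr_inv (x y : S) (f : iso x y) :
  Arrow f = Arrow (idm x) -> Arrow (iso_inv f) = Arrow (idm y).
Proof.
move=> e; have exy : y = x := congr1 tgt e; subst y.
have := iso_homK f; rewrite (arr_inj e) comp1m => ->; by [].
Qed.

Definition atens (A B : arrow) : arrow := Arrow (mor A ⊞ mor B).

Lemma atensE (x y x' y' : S) (f : hom x y) (g : hom x' y') :
  Arrow (f ⊞ g) = atens (Arrow f) (Arrow g).
Proof. by []. Qed.

Lemma arr_a (x y z : S) : Arrow a_[x, y, z] = Arrow (idm (x ⊕ (y ⊕ z))).
Proof. exact: arr_identity (strict_a hS x y z). Qed.

Lemma arr_tgt (x y : S) (f : hom x y) :
  Arrow f = Arrow (idm x) -> Arrow f = Arrow (idm y).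
Proof. by move=> e; have exy : y = x := congr1 tgt e; subst y. Qed.

Lemma arr_aV (x y z : S) : Arrow a^-1_[x, y, z] = Arrow (idm (x ⊕ y ⊕ z)).
Proof. exact/arr_inv/arr_a. Qed.

Lemma atensA (A B D : arrow) : atens A (atens B D) = atens (atens A B) D.
Proof.
case: A B D => [x x' f] [y y' g] [z z' h].
rewrite -!atensE.
rewrite -(arr_compl (f ⊞ (g ⊞ h)) (g := a_[x', y', z'])) ?arr_a // assoc_nat.
by rewrite arr_compr //; apply: arr_tgt; rewrite arr_a.
Qed.

Definition aid (n : nat) : arrow := Arrow (idm (underline n : S)).

Lemma aid_add (m n : nat) : aid (m + n) = atens (aid m) (aid n).
Proof. by rewrite /aid -atensE tensm1 -underline_add. Qed.

Definition ac : arrow := Arrow c_[rig1 : S, rig1].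

Lemma arr_transp (n i : nat) (hi : i.+1 < n) :
  Arrow (transp hi) = atens (atens (aid i) ac) (aid (n - i.+2)).
Proof.
rewrite /transp -!atensE.
rewrite arr_compr; last by apply: arr_tgt; rewrite arr_eq_hom.
by rewrite arr_compl // arr_eq_hom.
Qed.

Lemma transp_sq (n i : nat) (hi : i.+1 < n) : transp hi ∘ transp hi = idm _.
Proof.
apply: arr_inj.
have /arr_comp/(_ (arr_transp hi)) -> := arr_transp hi.
by rewrite -!tensm_comp braidK !comp1m !tensm1 -underline_split.
Qed.

Lemma transp_far (n i j : nat) (hi : i.+1 < n) (hj : j.+1 < n) : i.+1 < j ->
  transp hi ∘ transp hj = transp hj ∘ transp hi.
Proof.
move=> hij; apply: arr_inj.
pose p := j - i.+2.
pose f := (idm (underline i) ⊞ c_[rig1, rig1] : hom (_ : S) _) ⊞ idm (underline p).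
pose g := (c_[rig1, rig1] ⊞ idm (underline (n - j.+2)) : hom (_ : S) _).
have ei : Arrow (transp hi) = Arrow (f ⊞ idm (rig1 ⊕ rig1 ⊕ underline (n - j.+2))).
  rewrite arr_transp.
  have -> : n - i.+2 = p + (2 + (n - j.+2)) by rewrite /p; lia.
  transitivity (atens (atens (atens (aid i) ac) (aid p))
                      (atens (aid 2) (aid (n - j.+2)))).
    by rewrite !aid_add !atensA.
  by rewrite -[in RHS]tensm1.
have ej : Arrow (transp hj) =
    Arrow (idm (underline i ⊕ (rig1 ⊕ rig1) ⊕ underline p) ⊞ g).
  rewrite arr_transp.
  have -> : aid j = aid (i + 2 + p) by congr aid; rewrite /p; lia.
  transitivity (atens (atens (atens (aid i) (aid 2)) (aid p))
                      (atens ac (aid (n - j.+2)))).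
    by rewrite !aid_add !atensA.
  by rewrite -[in RHS]tensm1 -[in RHS]tensm1.
rewrite (arr_comp ei ej) (arr_comp ej ei) -!tensm_comp.
by rewrite !comp1m !compm1.
Qed.

Lemma transp_braid (n i : nat) (hi : i.+1 < n) (hj : i.+2 < n) :
  transp hi ∘ (transp hj ∘ transp hi) = transp hj ∘ (transp hi ∘ transp hj).
Proof.
apply: arr_inj.
pose c1 := c_[rig1, rig1] ⊞ idm rig1 : hom (rig1 ⊕ rig1 ⊕ rig1 : S) _.
pose k := a_[rig1, rig1, rig1] ∘ (idm rig1 ⊞ c_[rig1, rig1]) ∘ a^-1_[rig1, rig1, rig1]
  : hom (rig1 ⊕ rig1 ⊕ rig1 : S) _.
pose p := n - i.+3.
pose w (f : hom (rig1 ⊕ rig1 ⊕ rig1 : S) (rig1 ⊕ rig1 ⊕ rig1)) :=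
  idm (underline i) ⊞ f ⊞ idm (underline p).
have wc f g : w f ∘ w g = w (f ∘ g) by rewrite /w -!tensm_comp !comp1m.
have ei : Arrow (transp hi) = Arrow (w c1).
  rewrite arr_transp.
  have -> : n - i.+2 = 1 + p by rewrite /p; lia.
  by rewrite aid_add !atensE !atensA.
have ej : Arrow (transp hj) = Arrow (w k).
  rewrite arr_transp -/p -addn1 aid_add !atensE.
  have -> : Arrow k = atens (aid 1) ac.
    rewrite arr_compr; last by apply: arr_tgt; rewrite arr_aV.
    by rewrite arr_compl // arr_a.
  by rewrite !atensA.
have yb : c1 ∘ (k ∘ c1) = k ∘ (c1 ∘ k).
  have ck : c1 ∘ k = a_[rig1, rig1, rig1] ∘ c_[rig1 ⊕ rig1, rig1].
    rewrite /k !compA -hexagon -!compA iso_homK compm1; by [].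
  rewrite compA ck -compA braid_nat /k -!compA (compA a^-1_[_, _, _]).
  by rewrite iso_invK comp1m.
by rewrite (arr_comp ei (arr_comp ej ei)) (arr_comp ej (arr_comp ei ej)) !wc yb.
Qed.

End Strict.

Definition adj (i k : nat) : nat :=
  if k == i then i.+1 else if k == i.+1 then i else k.

Definition perm_word (w : seq nat) (k : nat) : nat := foldr adj k w.

Lemma perm_word_cat (v w : seq nat) (k : nat) :
  perm_word (v ++ w) k = perm_word v (perm_word w k).
Proof. by rewrite /perm_word foldr_cat. Qed.

Lemma adjK (i : nat) : involutive (adj i).
Proof. by move=> k; rewrite /adj; do !case: eqP; lia. Qed.

Lemma perm_word_revK (w : seq nat) : cancel (perm_word w) (perm_word (rev w)).
Proof.
elim: w => [|i w IHw] k //.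
by rewrite rev_cons -cats1 perm_word_cat /= adjK IHw.
Qed.

Lemma perm_word_revVK (w : seq nat) : cancel (perm_word (rev w)) (perm_word w).
Proof. by move=> k; rewrite -[w in perm_word w]revK perm_word_revK. Qed.

Lemma perm_word_inj (w : seq nat) : injective (perm_word w).
Proof. exact: can_inj (perm_word_revK w). Qed.

Lemma perm_word_fix (n : nat) (w : seq nat) (k : nat) :
  all (fun i => i < n) w -> n < k -> perm_word w k = k.
Proof.
elim: w => [|i w IHw] //= /andP[hi hw] hk.
by rewrite IHw // /adj; do !case: eqP; lia.
Qed.

Lemma perm_word_iota (k m : nat) : perm_word (iota k m) (k + m) = k.
Proof.
elim: m k => [|m IHm] k /=; first by rewrite addn0.
by rewrite addnS -addSn IHm /adj eqxx; case: eqP; lia.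
Qed.

Inductive weq (n : nat) : seq nat -> seq nat -> Prop :=
| weq_refl w : weq n w w
| weq_sym v w : weq n v w -> weq n w v
| weq_trans u v w : weq n u v -> weq n v w -> weq n u w
| weq_cat v v' w w' : weq n v v' -> weq n w w' -> weq n (v ++ w) (v' ++ w')
| weq_sq i : i < n -> weq n [:: i; i] [::]
| weq_far i j : i.+1 < j -> j < n -> weq n [:: i; j] [:: j; i]
| weq_braid i : i.+1 < n -> weq n [:: i; i.+1; i] [:: i.+1; i; i.+1].

Lemma weq_perm (n : nat) (v w : seq nat) : weq n v w -> perm_word v =1 perm_word w.
Proof.
elim=> {v w} [w k|v w _ e k|u v w _ e _ e' k|v v' w w' _ e _ e' k|i _ k|i j ij _ k|i _ k] //.
- by rewrite e e'.
- by rewrite !perm_word_cat e' e.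
- by rewrite /= adjK.
- by rewrite /= /adj; do !case: eqP; lia.
- by rewrite /= /adj; do !case: eqP; lia.
Qed.

Lemma weq_catl (n : nat) (u v w : seq nat) : weq n v w -> weq n (u ++ v) (u ++ w).
Proof. exact/weq_cat/weq_refl. Qed.

Lemma weq_catr (n : nat) (u v w : seq nat) : weq n v w -> weq n (v ++ u) (w ++ u).
Proof. by move=> e; apply: weq_cat e (weq_refl _ _). Qed.

Lemma weq_commute (n i : nat) (w : seq nat) : i < n -> all (fun j => j < n) w ->
  all (fun j => (i.+1 < j) || (j.+1 < i)) w -> weq n (i :: w) (w ++ [:: i]).
Proof.
move=> hi; elim: w => [|j w IHw] /=; first by move=> _ _; apply: weq_refl.
move=> /andP[hj hw] /andP[hij hiw].
apply: (@weq_trans _ _ [:: j, i & w]); last exact: (@weq_catl _ [:: j]) (IHw hw hiw).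
apply: (@weq_catr _ w [:: i; j] [:: j; i]).
case/orP: hij => hij; first exact: weq_far.
exact/weq_sym/weq_far.
Qed.

Lemma weq_nf (n : nat) (w : seq nat) : all (fun i => i < n.+1) w ->
  exists k w', [/\ k <= n.+1, all (fun i => i < n) w'
                 & weq n.+1 w (iota k (n.+1 - k) ++ w')].
Proof.
elim: w => [|i w IHw] /=.
  by exists n.+1, [::]; split=> //; rewrite subnn; apply: weq_refl.
move=> /andP[hi /IHw [k [w' [hk hw' e]]]].
have {}e : weq n.+1 (i :: w) (i :: iota k (n.+1 - k) ++ w').
  exact: (@weq_catl _ [:: i]).
have [hik|hki] := ltnP i k; last first.
  have [eik|nik] := eqVneq i k.
    exists k.+1, w'; split=> //; first by subst; lia.
    apply: weq_trans e _; apply: (@weq_catr _ w' (i :: _)).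
    have -> : n.+1 - k = (n.+1 - k.+1).+1 by lia.
    by rewrite /= -eik; apply: (@weq_catr _ _ [:: i; i] [::]); apply: weq_sq.
  have {}hki : k < i by rewrite ltn_neqAle eq_sym nik.
  exists k, (i.-1 :: w'); split=> //; first by rewrite /= hw' andbT; lia.
  apply: weq_trans e _.
  have -> : iota k (n.+1 - k) =
      iota k (i.-1 - k) ++ [:: i.-1; i] ++ iota i.+1 (n.+1 - i.+1).
    have -> : n.+1 - k = (i.-1 - k) + (2 + (n.+1 - i.+1)) by lia.
    rewrite !iotaD; congr (_ ++ (_ ++ _)); last by congr iota; lia.
    by rewrite /=; congr [:: _; _]; lia.
  set A := iota k _; set B := iota i.+1 _.
  have hA : all (fun j => j < n.+1) A by apply/allP=> j; rewrite mem_iota; lia.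
  have hB : all (fun j => j < n.+1) B by apply/allP=> j; rewrite mem_iota; lia.
  apply: (@weq_trans _ _ (A ++ [:: i] ++ [:: i.-1; i] ++ B ++ w')).
    rewrite -!catA [_ ++ ([:: i] ++ _)]catA; apply: (@weq_catr _ _ (i :: A)).
    apply: weq_commute => //.
    by apply/allP=> j; rewrite mem_iota; lia.
  rewrite -!catA; apply: weq_catl.
  apply: (@weq_trans _ _ ([:: i.-1; i; i.-1] ++ B ++ w')).
    apply: (@weq_catr _ _ [:: i; i.-1; i]); apply: weq_sym.
    by have := @weq_braid n.+1 i.-1; rewrite prednK ?(leq_ltn_trans _ hki) //; apply.
  apply: (@weq_catl _ [:: i.-1; i]).
  have -> : B ++ i.-1 :: w' = (B ++ [:: i.-1]) ++ w' by rewrite -catA.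
  apply: (@weq_catr _ _ (i.-1 :: B)); apply: weq_commute => //; first by lia.
  by apply/allP=> j; rewrite mem_iota; lia.
have [eik|nik] := eqVneq i.+1 k.
  exists i, w'; split=> //; first by lia.
  suff -> : iota i (n.+1 - i) = i :: iota k (n.+1 - k) by [].
  have -> : n.+1 - i = (n.+1 - i.+1).+1 by lia.
  by rewrite /= eik.
exists k, (i :: w'); split=> //; first by rewrite /= hw' andbT; lia.
apply: weq_trans e _.
have -> : iota k (n.+1 - k) ++ i :: w' = (iota k (n.+1 - k) ++ [:: i]) ++ w'.
  by rewrite -catA.
apply: (@weq_catr _ _ (i :: _)); apply: weq_commute => //.
  by apply/allP=> j; rewrite mem_iota; lia.
by apply/allP=> j; rewrite mem_iota; lia.
Qed.

Lemma weq_mono (n : nat) (v w : seq nat) : weq n v w -> weq n.+1 v w.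
Proof.
elim=> {v w} *; first exact: weq_refl.
- exact: weq_sym.
- by apply: weq_trans; eassumption.
- exact: weq_cat.
- by apply: weq_sq; lia.
- by apply: weq_far; lia.
- by apply: weq_braid; lia.
Qed.

(* The Coxeter presentation of the symmetric groups. *)
Lemma coxeter (n : nat) (v w : seq nat) :
  all (fun i => i < n) v -> all (fun i => i < n) w ->
  perm_word v =1 perm_word w -> weq n v w.
Proof.
elim: n v w => [|n IHn] v w.
  by case: v => [|? ?] //; case: w => [|? ?] // *; apply: weq_refl.
move=> /weq_nf [k [v' [hk hv ev]]] /weq_nf [l [w' [hl hw ew]]] evw.
have e i : perm_word (iota k (n.+1 - k)) (perm_word v' i)
         = perm_word (iota l (n.+1 - l)) (perm_word w' i).
  by rewrite -!perm_word_cat -(weq_perm ev) -(weq_perm ew).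
have ekl : k = l.
  have := e n.+1; rewrite (perm_word_fix hv) // (perm_word_fix hw) //.
  have := perm_word_iota k (n.+1 - k); have := perm_word_iota l (n.+1 - l).
  by rewrite !subnKC // => -> ->.
subst l; apply: weq_trans ev _; apply: weq_trans _ (weq_sym ew).
apply/weq_catl/weq_mono/IHn => // i.
exact: perm_word_inj (e i).
Qed.

Lemma perm_word_surj (n : nat) (f : nat -> nat) :
  injective f -> (forall k, n < k -> f k = k) ->
  exists w, all (fun i => i < n) w /\ perm_word w =1 f.
Proof.
elim: n f => [|n IHn] f fI fix_f.
  exists [::]; split=> // -[|k] /=; last by rewrite fix_f.
  by case e: (f 0) => [|k] //; have := fI 0 k.+1; rewrite e fix_f // => /(_ erefl).
pose k := f n.+1.
have hk : k <= n.+1.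
  rewrite leqNgt; apply/negP=> hk.
  by have := fix_f k hk => /fI; lia.
pose w := iota k (n.+1 - k).
have hw : all (fun i => i < n.+1) w by apply/allP=> j; rewrite mem_iota; lia.
have hrw : all (fun i => i < n.+1) (rev w) by rewrite all_rev.
have [||w' [hw' e]] := IHn (perm_word (rev w) \o f).
- exact: inj_comp (@perm_word_inj _) fI.
- move=> i; rewrite leq_eqVlt /= => /orP[/eqP <-|hi].
    apply: (@perm_word_inj w); rewrite perm_word_revVK.
    by have := perm_word_iota k (n.+1 - k); rewrite subnKC.
  by rewrite fix_f // (@perm_word_fix n.+1).
exists (w ++ w'); split.
  rewrite all_cat hw; apply/allP=> j /(allP hw'); lia.
by move=> i; rewrite perm_word_cat e /= perm_word_revVK.
Qed.

#[local] Arguments underline {S} n : simpl never.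

Section Canonical.

Variables (S : rig_category) (hS : left_semistrict S).

Definition gen (n i : nat) : hom (underline n : S) (underline n) :=
  match Sumbool.sumbool_of_bool (i.+1 < n) with
  | left hi => transp hS hi
  | right _ => idm (underline n)
  end.

Lemma genE (n i : nat) (hi : i.+1 < n) : gen n i = transp hS hi.
Proof.
rewrite /gen; case: Sumbool.sumbool_of_bool => [hi'|]; last by rewrite hi.
by rewrite (Prop_irrelevance hi' hi).
Qed.

Definition ev (n : nat) (w : seq nat) : hom (underline n : S) (underline n) :=
  foldr (fun i f => gen n i ∘ f) (idm (underline n)) w.

Lemma ev_cat (n : nat) (v w : seq nat) : ev n (v ++ w) = ev n v ∘ ev n w.
Proof. by elim: v => [|i v IHv] /=; rewrite ?comp1m // IHv compA. Qed.

Lemma ev_weq (n : nat) (v w : seq nat) : weq n v w -> ev n.+1 v = ev n.+1 w.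
Proof.
elim=> {v w} [w|v w _ ->|u v w _ -> _ ->|v v' w w' _ e _ e'|i hi|i j hij hj|i hi] //.
- by rewrite !ev_cat e e'.
- have hi' : i.+1 < n.+1 by lia.
  by rewrite /= (genE hi') compm1 transp_sq.
- have hi' : i.+1 < n.+1 by lia.
  have hj' : j.+1 < n.+1 by lia.
  by rewrite /= (genE hi') (genE hj') !compm1 transp_far.
- have hi' : i.+1 < n.+1 by lia.
  by rewrite /= (genE hi') (genE (hi : i.+2 < n.+1)) !compm1 transp_braid.
Qed.

Definition Fcan_rel (m n : nat) (s : bij m n)
    (f : hom (underline m : S) (underline n)) : Prop :=
  m = n /\ exists w, [/\ all (fun i => i.+1 < m) w,
    forall i, s i = perm_word w i :> nat & Arrow f = Arrow (ev m w)].

Lemma bij_eq_size (m n : nat) (s : bij m n) : m = n.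
Proof.
have := bij_eq_card (Bijective (bij_funK s) (bij_invK s)).
by rewrite !card_ord.
Qed.

Lemma bij_word (n : nat) (s : bij n n) :
  exists w, all (fun i => i.+1 < n) w /\ forall i, s i = perm_word w i :> nat.
Proof.
case: n s => [|n] s; first by exists [::]; split=> // -[].
pose f k := if k <= n then val (s (inord k)) else k.
have [||w [hw e]] := @perm_word_surj n f.
- move=> i j; rewrite /f; case: leqP => hi; case: leqP => hj //.
  + move/val_inj/(can_inj (bij_funK s))/(congr1 val).
    by rewrite /= !inordK.
  + by have := ltn_ord (s (inord i)) => /= + e; rewrite e; lia.
  + by have := ltn_ord (s (inord j)) => /= + e; rewrite -e; lia.
- by move=> k hk; rewrite /f leqNgt hk.
exists w; split=> // i; rewrite e /f -ltnS ltn_ord.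
by congr (val (s _)); apply: val_inj; rewrite /= inordK.
Qed.

Lemma Fcan_rel_total (m n : nat) (s : bij m n) : exists f, Fcan_rel s f.
Proof.
have e := bij_eq_size s; subst n.
by have [w [hw ew]] := bij_word s; exists (ev m w); split=> //; exists w.
Qed.

Lemma Fcan_rel_fun (m n : nat) (s : bij m n) (f g : hom (underline m) (underline n)) :
  Fcan_rel s f -> Fcan_rel s g -> f = g.
Proof.
move=> [e [v [hv ev ef]]] [_ [w [hw ew eg]]]; subst n.
apply: arr_inj; rewrite ef eg; congr Arrow.
case: m => [|m] in s f g v w hv ev ef hw ew eg *.
  by case: v w hv hw {ev ew ef eg} => [|? ?] // [].
apply/ev_weq/coxeter => // k; have [hk|hk] := leqP k m.
  by rewrite -[k]/(val (Ordinal (hk : k < m.+1))) -ev -ew.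
by rewrite !(@perm_word_fix m).
Qed.

Lemma Fcan_rel_id (n : nat) : Fcan_rel (bij_id n) (idm (underline n)).
Proof. by split=> //; exists [::]. Qed.

Lemma Fcan_rel_comp (m n p : nat) (s : bij m n) (t : bij n p)
    (f : hom (underline m) (underline n)) (g : hom (underline n) (underline p)) :
  Fcan_rel s f -> Fcan_rel t g -> Fcan_rel (bij_comp t s) (g ∘ f).
Proof.
move=> [e [v [hv ev ef]]] [e' [w [hw ew eg]]]; subst n p.
split=> //; exists (w ++ v); split; first by rewrite all_cat hw hv.
  by move=> i; rewrite perm_word_cat -ev -ew.
by rewrite ev_cat (arr_inj ef) (arr_inj eg).
Qed.

Lemma tperm_adj (n i : nat) (hi : i.+1 < n) (k : 'I_n) :
  tperm (Ordinal (ltnW hi)) (Ordinal hi) k = adj i k :> nat.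
Proof.
rewrite /adj permE /= -!val_eqE /=.
by case: eqP => //= _; case: eqP.
Qed.

Lemma Fcan_rel_transp (n i : nat) (hi : i.+1 < n) :
  Fcan_rel (bij_perm (tperm (Ordinal (ltnW hi)) (Ordinal hi))) (transp hS hi).
Proof.
split=> //; exists [:: i]; split; first by rewrite /= hi.
  by move=> k; apply: tperm_adj.
by rewrite /= compm1 (genE hi).
Qed.

Lemma Fcan_exists : exists F1, is_Fcan hS F1.
Proof.
have ex m n (s : bij m n) := cid (Fcan_rel_total s).
exists (fun m n s => projT1 (ex m n s)); split; first split.
- move=> n; apply: Fcan_rel_fun (Fcan_rel_id n).
  exact: projT2 (ex n n (bij_id n)).
- move=> m n p t s; apply: Fcan_rel_fun (projT2 (ex m p (bij_comp t s))) _.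
  exact: Fcan_rel_comp (projT2 (ex m n s)) (projT2 (ex n p t)).
- move=> n i hi; apply: Fcan_rel_fun (projT2 (ex _ _ _)) _.
  exact: Fcan_rel_transp.
Qed.

Lemma is_Fcan_rel F1 (m n : nat) (s : bij m n) : is_Fcan hS F1 -> Fcan_rel s (F1 m n s).
Proof.
move=> [[F1id F1comp] F1gen].
have e := bij_eq_size s; subst n.
have [w [hw ew]] := bij_word s.
elim: w => [|i w IHw] in s hw ew *.
  have -> : s = bij_id m by apply: bij_ext => i; apply: val_inj; apply: ew.
  by rewrite (F1id m : F1 m m (bij_id m) = _); apply: Fcan_rel_id.
have /= /andP[hi {}hw] := hw.
pose t := bij_perm (tperm (Ordinal (ltnW hi)) (Ordinal hi)).
have es : s = bij_comp t (bij_comp t s).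
  by apply: bij_ext => k /=; rewrite tpermK.
rewrite [in F1 _ _ _]es [X in Fcan_rel X]es.
rewrite (F1comp m m m t (bij_comp t s) : F1 m m (bij_comp t (bij_comp t s)) = _).
apply: Fcan_rel_comp; last by rewrite F1gen; apply: Fcan_rel_transp.
apply: IHw => // k; by rewrite /t /= tperm_adj ew /= adjK.
Qed.

Lemma Fcan_unique F1 F1' : is_Fcan hS F1 -> is_Fcan hS F1' ->
  forall m n s, F1 m n s = F1' m n s.
Proof.
move=> h h' m n s; exact: Fcan_rel_fun (is_Fcan_rel s h) (is_Fcan_rel s h').
Qed.

Definition Fcan : forall m n : FSet_sk, hom m n -> hom (underline m : S) (underline n) :=
  projT1 (cid Fcan_exists).

Lemma FcanP : is_Fcan hS Fcan.
Proof. exact: projT2 (cid Fcan_exists). Qed.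

End Canonical.

Lemma tensm_isoK (C : category) (M : monoidal C) (x x' y y' : C)
    (f : iso x x') (g : iso y y') :
  tensm M (iso_inv f) (iso_inv g) ∘ tensm M f g = idm (tens M x y).
Proof. by rewrite -tensm_comp !iso_invK tensm1. Qed.

Lemma tensm_isoKV (C : category) (M : monoidal C) (x x' y y' : C)
    (f : iso x x') (g : iso y y') :
  tensm M f g ∘ tensm M (iso_inv f) (iso_inv g) = idm (tens M x' y').
Proof. by rewrite -tensm_comp !iso_homK tensm1. Qed.

Definition tens_iso (C : category) (M : monoidal C) (x x' y y' : C)
    (f : iso x x') (g : iso y y') : iso (tens M x y) (tens M x' y') :=
  Iso (tensm_isoK M f g) (tensm_isoKV M f g).

Section FTau.

Variables (S : rig_category) (hS : left_semistrict S).
Variables (x : nat -> S) (tau : forall n, iso (x n) (underline n)).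

(* [hom m n] is inhabited only for m = n; on S_n this is conjugation by tau n. *)
Definition Ftau (m n : FSet_sk) (s : hom m n) : hom (x m) (x n) :=
  iso_inv (tau n) ∘ Fcan hS s ∘ tau m.

(* On objects of [FSet_sk], m ⊕ n is m + n and m ⊗ n is m * n; [underline_add]
   and [underline_mul] are equations between objects, by strictness. *)
Definition phi_add (m n : FSet_sk) : hom (x (m ⊕ n)) (x m ⊕ x n) :=
  iso_inv (tens_iso (rig_add S) (tau m) (tau n))
    ∘ eq_hom (underline_add hS m n) ∘ tau (m ⊕ n).

Definition phi_mul (m n : FSet_sk) : hom (x (m ⊗ n)) (x m ⊗ x n) :=
  iso_inv (tens_iso (rig_mul S) (tau m) (tau n))
    ∘ eq_hom (underline_mul hS m n) ∘ tau (m ⊗ n).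

End FTau.

(* Main.v *)
From mathcomp Require Import all_boot all_fingroup zify.
Require Import Defs.

Set Implicit Arguments.
Unset Strict Implicit.
Unset Printing Implicit Defensive.

#[local] Arguments underline {S} n : simpl never.

(** The maps [tau n] only conjugate. A homomorphism of rig categories can be
    transported along any family of isomorphisms [tau x] from new object values
    [F0 x] to the old ones [G0 x]: every structure map of the transported data
    fits, with the corresponding old one, in a commuting square whose sides are
    built from the [tau x], such squares can be composed and tensored, and so
    every axiom of the old homomorphism carries over
    ([transport_rig_homomorphism]). It remains to see that [Fcan] itself,
    equipped with the identities [underline (m + n) = underline m ⊕ underline n]
    and [underline (m * n) = underline m ⊗ underline n], is a homomorphism
    ([canonical_rig_homomorphism]); that is, that [Fcan] strictly preserves
    ⊞, ⊠, the additive braiding and the right distributor, everything else being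
    an identity on both sides.

    Each of these four facts is obtained by making one computation twice, once
    in the permutations and once in the target, because both are left
    semistrict and the computation uses nothing but the laws of such a
    rig category.
    - ⊞: the morphisms of the source are generated by id_i ⊞ c_{1,1} ⊞ id_k
      ([bij_gen_ind]), whose image is known, and adding an identity on either
      side to such a generator yields another generator.
    - Braiding: the hexagon expresses c_{x ⊕ y, z} through c_{x,z} and c_{y,z},
      which reduces all braidings to c_{1,1}.
    - Right distributor: the axiom comparing the two ways of expanding
      (x ⊕ y) ⊗ (z ⊕ t) expresses d'_{x, y, z ⊕ t} through d'_{x,y,z}, d'_{x,y,t}
      and a braiding, and d'_{x,y,0} and d'_{x,y,1} are identities.
    - ⊠: by naturality of the strict left distributor, f ⊠ id_n is the n-fold
      sum of f, while id_n ⊠ - is additive and maps c_{y,z} to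
      c_{n ⊗ y, n ⊗ z}.

    The two sides of these equations have sources and targets that are equal but
    not convertible. They are therefore compared as elements of the type [arrow],
    on which ⊞ and ⊠ become the operations [atens] and [amul]; [Fcan] induces
    a map [Fcan_arr] on arrows, so an equality of arrows between permutations may
    be pushed through [Fcan] without any cast. *)

(** * Transport of a homomorphism along isomorphisms *)

Section Squares.

Variable C : category.

(** When [u] and [v] are isomorphisms, [f] is the conjugate of [g] along them. *)
Definition square (x y x' y' : C) (u : hom x x') (v : hom y y')
    (f : hom x y) (g : hom x' y') : Prop := v ∘ f = g ∘ u.

Lemma square_id (x x' : C) (u : hom x x') : square u u (idm x) (idm x').
Proof. by rewrite /square comp1m compm1. Qed.

Lemma square_comp (x y z x' y' z' : C) (u : hom x x') (v : hom y y') (w : hom z z')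
    (f : hom x y) (f' : hom x' y') (g : hom y z) (g' : hom y' z') :
  square u v f f' -> square v w g g' -> square u w (g ∘ f) (g' ∘ f').
Proof. by rewrite /square => e e'; rewrite compA e' -compA e compA. Qed.

Lemma square_tensm (M : monoidal C) (x1 y1 x1' y1' x2 y2 x2' y2' : C)
    (u1 : hom x1 x1') (v1 : hom y1 y1') (f1 : hom x1 y1) (g1 : hom x1' y1')
    (u2 : hom x2 x2') (v2 : hom y2 y2') (f2 : hom x2 y2) (g2 : hom x2' y2') :
  square u1 v1 f1 g1 -> square u2 v2 f2 g2 ->
  square (tensm M u1 u2) (tensm M v1 v2) (tensm M f1 f2) (tensm M g1 g2).
Proof. by rewrite /square => e1 e2; rewrite -!tensm_comp e1 e2. Qed.

(** Equations descend along squares because the right-hand side can be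
    cancelled. *)
Lemma square_eq (x y x' y' : C) (u : hom x x') (v : hom y y')
    (f1 f2 : hom x y) (g1 g2 : hom x' y') :
  g1 = g2 -> square u v f1 g1 -> square u v f2 g2 -> is_iso v -> f1 = f2.
Proof.
move=> -> e1 e2 [w [wv _]].
by rewrite -[f1]comp1m -[f2]comp1m -wv -!compA e1 e2.
Qed.

Lemma is_iso_iso (x y : C) (f : iso x y) : is_iso f.
Proof. by exists (iso_inv f); rewrite iso_invK iso_homK. Qed.

Lemma is_iso_id (x : C) : is_iso (idm x).
Proof. by exists (idm x); rewrite comp1m. Qed.

Lemma is_iso_inv (x y : C) (f : iso x y) : is_iso (iso_inv f).
Proof. by exists f; rewrite iso_invK iso_homK. Qed.

Lemma is_iso_comp (x y z : C) (f : hom x y) (g : hom y z) :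
  is_iso f -> is_iso g -> is_iso (g ∘ f).
Proof.
move=> [f' [f'f ff']] [g' [g'g gg']]; exists (f' ∘ g'); split.
  by rewrite compA -[_ ∘ g' ∘ g]compA g'g compm1.
by rewrite compA -[_ ∘ f ∘ f']compA ff' compm1.
Qed.

Lemma is_iso_tensm (M : monoidal C) (x y x' y' : C) (f : hom x y) (g : hom x' y') :
  is_iso f -> is_iso g -> is_iso (tensm M f g).
Proof.
move=> [f' [f'f ff']] [g' [g'g gg']]; exists (tensm M f' g').
by rewrite -!tensm_comp f'f ff' g'g gg' !tensm1.
Qed.

End Squares.

Section Transport.

Variables (S T : rig_category) (G0 : S -> T)
  (G1 : forall x y : S, hom x y -> hom (G0 x) (G0 y))
  (gA : forall x y : S, hom (G0 (x ⊕ y)) (G0 x ⊕ G0 y)) (eA : hom (G0 rig0) rig0)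
  (gM : forall x y : S, hom (G0 (x ⊗ y)) (G0 x ⊗ G0 y)) (eM : hom (G0 rig1) rig1).
Hypothesis hG : is_rig_homomorphism G1 gA eA gM eM.
Variables (F0 : S -> T) (tau : forall x, iso (F0 x) (G0 x)).

Definition transport_hom (x y : S) (f : hom x y) : hom (F0 x) (F0 y) :=
  iso_inv (tau y) ∘ G1 f ∘ tau x.

Definition transport_add (x y : S) : hom (F0 (x ⊕ y)) (F0 x ⊕ F0 y) :=
  iso_inv (tens_iso (rig_add T) (tau x) (tau y)) ∘ gA x y ∘ tau (x ⊕ y).

Definition transport_mul (x y : S) : hom (F0 (x ⊗ y)) (F0 x ⊗ F0 y) :=
  iso_inv (tens_iso (rig_mul T) (tau x) (tau y)) ∘ gM x y ∘ tau (x ⊗ y).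

Lemma square_hom (x y : S) (f : hom x y) :
  square (tau x) (tau y) (transport_hom f) (G1 f).
Proof. by rewrite /square /transport_hom !compA iso_homK comp1m. Qed.

Lemma square_add (x y : S) :
  square (tau (x ⊕ y)) (tau x ⊞ tau y) (transport_add x y) (gA x y).
Proof. by rewrite /square /transport_add !compA tensm_isoKV comp1m. Qed.

Lemma square_mul (x y : S) :
  square (tau (x ⊗ y)) (tau x ⊠ tau y) (transport_mul x y) (gM x y).
Proof. by rewrite /square /transport_mul !compA tensm_isoKV comp1m. Qed.

Lemma square_eps (x : S) (y : T) (e : hom (G0 x) y) :
  square (tau x) (idm y) (e ∘ tau x) e.
Proof. exact: comp1m. Qed.

(* The squares of the elementary structure maps are their naturality squares
   at [tau]; these are tried before splitting a composite or a tensor product. *)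
Ltac chase := repeat first
  [ apply: square_hom | apply: square_add | apply: square_mul | apply: square_eps
  | exact: (esym (assoc_nat _ _ _ _)) | exact: (esym (lunit_nat _ _))
  | exact: (esym (runit_nat _ _)) | exact: (esym (braid_nat _ _ _))
  | exact: (esym (ldistr_nat (rig_categoryP T) _ _ _))
  | exact: (esym (rdistr_nat (rig_categoryP T) _ _ _))
  | exact: (etrans (comp1m _) (esym (rnull_nat (rig_categoryP T) _)))
  | exact: (etrans (comp1m _) (esym (lnull_nat (rig_categoryP T) _)))
  | apply: square_id | apply: square_tensm | apply: square_comp ].

Ltac transport law := intros; eapply square_eq;
  [ eapply law | chase | chase
  | repeat first [ apply: is_iso_tensm | apply: is_iso_iso | apply: is_iso_id ] ].

(** Each axiom only involves composites and tensor products of maps that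
    correspond to each other along [tau]. *)
Lemma transport_rig_homomorphism :
  is_rig_homomorphism transport_hom transport_add (eA ∘ tau rig0)
    transport_mul (eM ∘ tau rig1).
Proof.
have isoA x y : is_iso (transport_add x y).
  apply: is_iso_comp (is_iso_iso _) (is_iso_comp (rhom_phiA_iso hG x y) _).
  exact: is_iso_inv.
have isoM x y : is_iso (transport_mul x y).
  apply: is_iso_comp (is_iso_iso _) (is_iso_comp (rhom_phiM_iso hG x y) _).
  exact: is_iso_inv.
split=> //.
- split.
  + by transport (functor_id (rhom_functor hG)).
  + by transport (functor_comp (rhom_functor hG)).
- exact: is_iso_comp (is_iso_iso _) (rhom_epsA_iso hG).
- transport (rhom_phiA_nat hG).
- transport (rhom_phiA_assoc hG).
- transport (rhom_phiA_lunit hG).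
- transport (rhom_phiA_runit hG).
- transport (rhom_phiA_braid hG).
- exact: is_iso_comp (is_iso_iso _) (rhom_epsM_iso hG).
- transport (rhom_phiM_nat hG).
- transport (rhom_phiM_assoc hG).
- transport (rhom_phiM_lunit hG).
- transport (rhom_phiM_runit hG).
- transport (rhom_ldistr hG).
- transport (rhom_rdistr hG).
- transport (rhom_rnull hG).
- transport (rhom_lnull hG).
Qed.

End Transport.

(** * Arrows of a left semistrict rig category *)

Lemma is_identity_comp (C : category) (x y z : C) (f : hom x y) (g : hom y z) :
  is_identity f -> is_identity g -> is_identity (g ∘ f).
Proof. by move=> hf; case: _ _ f / hf g => u g; rewrite compm1. Qed.

Lemma is_identity_tensm (C : category) (M : monoidal C) (x y x' y' : C)
    (f : hom x y) (g : hom x' y') :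
  is_identity f -> is_identity g -> is_identity (tensm M f g).
Proof. by case=> u [v]; rewrite tensm1; apply: IsIdentity. Qed.

Arguments is_identity_tensm {C M x y x' y' f g}.

Lemma is_identity_eq_hom (C : category) (x y : C) (e : x = y) : is_identity (eq_hom e).
Proof. by case: y / e; apply: IsIdentity. Qed.

Section ArrowCalculus.

Variables (S : rig_category) (hS : left_semistrict S).

(** This is how all coherence axioms between strict structure maps hold. *)
Lemma is_identity_unique (x y : S) (f g : hom x y) :
  is_identity f -> is_identity g -> f = g.
Proof. by move=> hf hg; apply: arr_inj; rewrite !arr_identity. Qed.

Lemma arr_identity_tgt (x y : S) (f : hom x y) : is_identity f -> Arrow f = Arrow (idm y).
Proof. by case. Qed.

Lemma arr_idl (x y z : S) (f : hom x y) (g : hom y z) :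
  is_identity g -> Arrow (g ∘ f) = Arrow f.
Proof. by move=> hg; case: _ _ g / hg f => u f; rewrite comp1m. Qed.

Lemma arr_idr (x y z : S) (f : hom x y) (g : hom y z) :
  is_identity f -> Arrow (g ∘ f) = Arrow g.
Proof. by move=> hf; case: _ _ f / hf g => u g; rewrite compm1. Qed.

(** A naturality square of a strict structure map is an equality of arrows. *)
Lemma arr_square (x y x' y' : S) (f : hom x y) (g : hom x' y')
    (u : hom x x') (v : hom y y') :
  is_identity u -> is_identity v -> v ∘ f = g ∘ u -> Arrow f = Arrow g.
Proof. by move=> hu hv e; rewrite -(arr_idl f hv) e arr_idr. Qed.

Lemma is_identity_inv (x y : S) (f : iso x y) : is_identity f -> is_identity (iso_inv f).
Proof.
move=> /arr_identity/arr_inv e.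
change (is_identity (mor (Arrow (iso_inv f)))).
by rewrite e; apply: IsIdentity.
Qed.

(** Inverses are determined also for morphisms whose endpoints are only
    propositionally equal. *)
Lemma arr_inverse (x y x' y' : S) (f : hom x y) (g : hom y x)
    (f' : hom x' y') (g' : hom y' x') :
  Arrow f = Arrow f' -> g ∘ f = idm x -> f' ∘ g' = idm y' -> Arrow g = Arrow g'.
Proof.
move=> e gf fg; have ex : x = x' := congr1 (@src S) e.
have ey : y = y' := congr1 (@tgt S) e.
subst x' y'; move/arr_inj: e fg => <- fg.
by rewrite -[g]compm1 -fg compA gf comp1m.
Qed.

Lemma atens0l (A : arrow S) : atens (Arrow (idm rig0)) A = A.
Proof.
case: A => x x' f; apply: (arr_square (strict_l hS x) (strict_l hS x')).
exact: lunit_nat.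
Qed.

Lemma atens0r (A : arrow S) : atens A (Arrow (idm rig0)) = A.
Proof.
case: A => x x' f; apply: (arr_square (strict_r hS x) (strict_r hS x')).
exact: runit_nat.
Qed.

Definition amul (A B : arrow S) : arrow S := Arrow (mor A ⊠ mor B).

Lemma amul_id (y z : S) :
  amul (Arrow (idm y)) (Arrow (idm z)) = Arrow (idm (y ⊗ z)).
Proof. by rewrite /amul /= tensm1. Qed.

(** Strictness of the left distributor. *)
Lemma amul_atens (A B D : arrow S) : amul A (atens B D) = atens (amul A B) (amul A D).
Proof.
case: A B D => [x x' f] [y y' g] [z z' h].
by apply: arr_square (ldistr_nat (rig_categoryP S) f g h); apply: strict_d.
Qed.

Lemma amul0 (A : arrow S) : amul A (Arrow (idm rig0)) = Arrow (idm rig0).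
Proof.
case: A => x x' f; apply: (arr_square (strict_n hS x) (strict_n hS x')).
by rewrite comp1m; apply: rnull_nat (rig_categoryP S) _ _ f.
Qed.

Lemma amul1 (A : arrow S) : amul A (Arrow (idm rig1)) = A.
Proof.
case: A => x x' f; apply: (arr_square (strict_r' hS x) (strict_r' hS x')).
exact: runit_nat.
Qed.

Lemma amul_braid (x y z : S) :
  amul (Arrow (idm x)) (Arrow c_[y, z]) = Arrow c_[x ⊗ y, x ⊗ z].
Proof.
apply: arr_square (ldistr_braid (rig_categoryP S) x y z); exact: strict_d.
Qed.

Lemma arr_braid_unit (x : S) : Arrow c_[x, rig0] = Arrow (idm x).
Proof.
rewrite -(arr_idl c_[x, rig0] (strict_l hS x)) braid_unit.
exact/arr_identity_tgt/strict_r.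
Qed.

Lemma arr_hexagon (x y z : S) :
  Arrow c_[x ⊕ y, z]
  = Arrow ((c_[x, z] ⊞ idm y) ∘ a_[x, z, y] ∘ (idm x ⊞ c_[y, z])).
Proof.
rewrite -hexagon arr_idr; last exact: strict_a.
by rewrite arr_idl //; apply: strict_a.
Qed.

Lemma arr_interchange (p q s u : S) :
  Arrow (interchange p q s u)
  = atens (atens (Arrow (idm p)) (Arrow c_[q, s])) (Arrow (idm u)).
Proof.
have aV x y z := is_identity_inv (strict_a hS x y z).
rewrite /interchange arr_idr; last exact: strict_a.
rewrite arr_idr; last exact: is_identity_tensm (aV _ _ _) (IsIdentity _).
rewrite -compA arr_idl; last exact: aV.
by rewrite arr_idl //; apply: is_identity_tensm (strict_a hS _ _ _) (IsIdentity _).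
Qed.

(** Up to identities, both maps braid the two middle summands. *)
Lemma interchangeK (p q s u : S) :
  interchange p s q u ∘ interchange p q s u = idm (p ⊕ q ⊕ (s ⊕ u)).
Proof.
apply: arr_inj.
rewrite (arr_comp (arr_interchange p s q u) (arr_interchange p q s u)).
rewrite -!tensm_comp braidK !comp1m !tensm1.
by rewrite /= !(strict_addA hS).
Qed.

Lemma arr_rdistr0 (x y : S) : Arrow d′_[x, y, rig0] = Arrow (idm rig0).
Proof.
have e := rnull_add (rig_categoryP S) x y.
rewrite -(arr_idl d′_[x, y, rig0]
  (is_identity_comp (is_identity_tensm (strict_n hS x) (strict_n hS y)) (strict_l hS _))).
by rewrite e; apply/arr_identity_tgt/strict_n.
Qed.

Lemma arr_rdistr1 (x y : S) : Arrow d′_[x, y, rig1] = Arrow (idm (x ⊕ y)).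
Proof.
have e := rdistr_rig1 (rig_categoryP S) x y.
rewrite -(arr_idl d′_[x, y, rig1]
  (is_identity_tensm (strict_r' hS x) (strict_r' hS y))) e.
exact/arr_identity_tgt/strict_r'.
Qed.

(** The law for expanding (x ⊕ y) ⊗ (z ⊕ t) in two ways, solved for the right
    distributor at z ⊕ t. *)
Lemma arr_rdistrD (x y z t : S) :
  Arrow d′_[x, y, z ⊕ t]
  = Arrow (interchange (x ⊗ z) (y ⊗ z) (x ⊗ t) (y ⊗ t)
             ∘ (d′_[x, y, z] ⊞ d′_[x, y, t])).
Proof.
move: (interchangeK (x ⊗ z) (x ⊗ t) (y ⊗ z) (y ⊗ t)).
have := lrdistr_add (rig_categoryP S) x y z t.
move: (interchange (x ⊗ z) (x ⊗ t) _ _) (interchange (x ⊗ z) (y ⊗ z) _ _) => v w e wv.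
rewrite -(arr_idr (w ∘ _) (strict_d hS (x ⊕ y) z t)) -compA -e !compA wv comp1m arr_idl //.
exact: is_identity_tensm (strict_d hS _ _ _) (strict_d hS _ _ _).
Qed.

End ArrowCalculus.

(** * Generators of the permutations *)

(** Written with i + (1 + 1) + k points, an adjacent transposition is built
    from the structure of the rig category alone. *)
Lemma bij_transp (i k : nat) (hi : i.+1 < i + (1 + 1) + k) :
  bij_perm (tperm (Ordinal (ltnW hi)) (Ordinal hi))
  = bij_add (bij_add (bij_id i) (bij_braid 1 1)) (bij_id k).
Proof.
apply: bij_ext => j; apply: val_inj; rewrite [LHS]tperm_adj.
split_idx; rewrite /bij_add_fun /= /bij_add_fun /braid_fun !idxE /= /adj.
all: try match goal with j : 'I_1 |- _ => rewrite (ord1 j) end => /=.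
all: try match goal with j : 'I_ _ |- _ => have := ltn_ord j end.
all: by repeat (case: eqP => //= ?); lia.
Qed.

(** The words in adjacent transpositions of [bij_word], read as composites. *)
Lemma bij_gen_ind (P : forall n : nat, bij n n -> Prop) :
  (forall n, P n (bij_id n)) ->
  (forall n (s t : bij n n), P n s -> P n t -> P n (bij_comp s t)) ->
  (forall i k, P (i + (1 + 1) + k)
     (bij_add (bij_add (bij_id i) (bij_braid 1 1)) (bij_id k))) ->
  forall n s, P n s.
Proof.
move=> P1 Pcomp Pgen n s; have [w [hw ew]] := bij_word s.
have Pt k i (e : n = i + (1 + 1) + k) (hi : i.+1 < n) :
    P n (bij_perm (tperm (Ordinal (ltnW hi)) (Ordinal hi))).
  by subst n; rewrite bij_transp; apply: Pgen.
elim: w => [|i w IHw] in s hw ew *.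
  by have -> : s = bij_id n by apply: bij_ext => i; apply: val_inj; apply: ew.
have /= /andP[hi {}hw] := hw.
pose t := bij_perm (tperm (Ordinal (ltnW hi)) (Ordinal hi)).
have -> : s = bij_comp t (bij_comp t s).
  by apply: bij_ext => k /=; rewrite tpermK.
apply: Pcomp; last by apply: IHw => // k; rewrite /= tperm_adj ew /= adjK.
by apply: (Pt (n - i.+2)); lia.
Qed.

(** * The canonical functor is a strict homomorphism *)

Section Canonical.

Variables (S : rig_category) (hS : left_semistrict S).

Definition Fcan_arr (A : arrow FSet_sk) : arrow S := Arrow (Fcan hS (mor A)).

Definition fid (n : FSet_sk) : arrow FSet_sk := Arrow (idm n).

Lemma Fcan_id (n : FSet_sk) : Fcan hS (idm n) = idm (underline n).
Proof. by case: (FcanP hS) => [[-> _] _]. Qed.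

Lemma Fcan_comp (m n p : FSet_sk) (g : hom n p) (f : hom m n) :
  Fcan hS (g ∘ f) = Fcan hS g ∘ Fcan hS f.
Proof. by case: (FcanP hS) => [[_ ->] _]. Qed.

Lemma is_identity_Fcan (m n : FSet_sk) (f : hom m n) :
  is_identity f -> is_identity (Fcan hS f).
Proof. by case=> k; rewrite Fcan_id; apply: IsIdentity. Qed.

Lemma Fcan_arr_id (n : FSet_sk) : Fcan_arr (fid n) = aid S n.
Proof. by rewrite /Fcan_arr /= Fcan_id. Qed.

Lemma Fcan_arr_comp (m n p : FSet_sk) (f : hom m n) (g : hom n p)
    (x y z : S) (f' : hom x y) (g' : hom y z) :
  Fcan_arr (Arrow g) = Arrow g' -> Fcan_arr (Arrow f) = Arrow f' ->
  Fcan_arr (Arrow (g ∘ f)) = Arrow (g' ∘ f').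
Proof. by move=> eg ef; rewrite /Fcan_arr /= Fcan_comp; apply: arr_comp. Qed.

Lemma fid_add (m n : FSet_sk) : fid (m ⊕ n) = atens (fid m) (fid n).
Proof. by rewrite /fid -atensE tensm1. Qed.

(** By [bij_transp], this is the value that defines [Fcan] on an adjacent
    transposition. *)
Lemma Fcan_arr_gen (i k : FSet_sk) :
  Fcan_arr (atens (atens (fid i) (Arrow c_[1 : FSet_sk, 1])) (fid k))
  = atens (atens (aid S i) (ac S)) (aid S k).
Proof.
have hi : i.+1 < i + (1 + 1) + k by lia.
have -> : aid S k = aid S (i + (1 + 1) + k - i.+2) by congr aid; lia.
by rewrite -(arr_transp hS hi) -(FcanP hS).2 bij_transp.
Qed.

(** [bij_gen_ind] for arrows: a bijection m -> n only exists when m = n. *)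
Lemma arrow_gen_ind (P : arrow FSet_sk -> Prop) :
  (forall n, P (fid n)) ->
  (forall (m n p : FSet_sk) (f : hom m n) (g : hom n p),
    P (Arrow f) -> P (Arrow g) -> P (Arrow (g ∘ f))) ->
  (forall i k : FSet_sk, P (atens (atens (fid i) (Arrow c_[1 : FSet_sk, 1])) (fid k))) ->
  forall A, P A.
Proof.
move=> P1 Pcomp Pgen [m n s]; have e := bij_eq_size s; subst n.
apply: (@bij_gen_ind (fun n s => P (@Arrow FSet_sk n n s))) => // n f g Pf Pg.
exact: (Pcomp n n n g f).
Qed.

(** On a generator, [fid n] is absorbed by the identity at its end. *)
Lemma Fcan_arr_atensl (A : arrow FSet_sk) (n : FSet_sk) :
  Fcan_arr (atens A (fid n)) = atens (Fcan_arr A) (aid S n).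
Proof.
elim/arrow_gen_ind: A => [m|m p q f g ef eg|i k].
- by rewrite -fid_add !Fcan_arr_id aid_add.
- have -> : atens (Arrow (g ∘ f)) (fid n) = Arrow ((g ⊞ idm n) ∘ (f ⊞ idm n)).
    by rewrite -tensm_comp comp1m.
  rewrite (Fcan_arr_comp eg ef) -tensm_comp comp1m.
  by rewrite /Fcan_arr /= Fcan_comp.
- rewrite -(atensA FSet_left_semistrict) -fid_add !Fcan_arr_gen aid_add //.
  by rewrite (atensA hS).
Qed.

Lemma Fcan_arr_atensr (A : arrow FSet_sk) (n : FSet_sk) :
  Fcan_arr (atens (fid n) A) = atens (aid S n) (Fcan_arr A).
Proof.
elim/arrow_gen_ind: A => [m|m p q f g ef eg|i k].
- by rewrite -fid_add !Fcan_arr_id aid_add.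
- have -> : atens (fid n) (Arrow (g ∘ f)) = Arrow ((idm n ⊞ g) ∘ (idm n ⊞ f)).
    by rewrite -tensm_comp comp1m.
  rewrite (Fcan_arr_comp eg ef) -tensm_comp comp1m.
  by rewrite /Fcan_arr /= Fcan_comp.
- rewrite !(atensA FSet_left_semistrict) -fid_add !Fcan_arr_gen aid_add //.
  by rewrite !(atensA hS).
Qed.

Lemma Fcan_arr_atens (A B : arrow FSet_sk) :
  Fcan_arr (atens A B) = atens (Fcan_arr A) (Fcan_arr B).
Proof.
case: A B => [m m' f] [n n' g].
have -> : atens (Arrow f) (Arrow g) = Arrow ((f ⊞ idm n') ∘ (idm m ⊞ g)).
  by rewrite -tensm_comp comp1m compm1.
rewrite (Fcan_arr_comp (Fcan_arr_atensl (Arrow f) n') (Fcan_arr_atensr (Arrow g) m)).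
by rewrite -tensm_comp comp1m compm1.
Qed.

(** The hexagon, read in the source and in the target. *)
Lemma Fcan_arr_braidD (m n p : FSet_sk) :
  Fcan_arr (Arrow c_[m, p]) = Arrow c_[underline m : S, underline p] ->
  Fcan_arr (Arrow c_[n, p]) = Arrow c_[underline n : S, underline p] ->
  Fcan_arr (Arrow c_[m ⊕ n, p]) = Arrow c_[underline (m ⊕ n) : S, underline p].
Proof.
move=> em en; rewrite (underline_add hS) (arr_hexagon FSet_left_semistrict).
rewrite (arr_hexagon hS); apply: Fcan_arr_comp; last first.
  by rewrite [LHS](Fcan_arr_atens (fid m) (Arrow _)) en Fcan_arr_id.
apply: Fcan_arr_comp.
  by rewrite [LHS](Fcan_arr_atens (Arrow _) (fid n)) em Fcan_arr_id.
rewrite [LHS]arr_identity; last first.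
  exact/is_identity_Fcan/(strict_a FSet_left_semistrict).
by rewrite (arr_a hS) !(underline_add hS).
Qed.

Lemma Fcan_arr_braid_sym (m n : FSet_sk) :
  Fcan_arr (Arrow c_[m, n]) = Arrow c_[underline m : S, underline n] ->
  Fcan_arr (Arrow c_[n, m]) = Arrow c_[underline n : S, underline m].
Proof.
move=> e; apply: (arr_inverse (e : Arrow (Fcan hS _) = _)); last exact: braidK.
by rewrite -Fcan_comp braidK Fcan_id.
Qed.

Lemma Fcan_arr_braid0 (m : FSet_sk) :
  Fcan_arr (Arrow c_[m, rig0]) = Arrow c_[underline m : S, rig0].
Proof.
by rewrite (arr_braid_unit FSet_left_semistrict) Fcan_arr_id (arr_braid_unit hS).
Qed.

Lemma Fcan_arr_braid1 (m : FSet_sk) :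
  Fcan_arr (Arrow c_[m, 1]) = Arrow c_[underline m : S, rig1].
Proof.
elim: m => [|m IHm]; first exact/Fcan_arr_braid_sym/(Fcan_arr_braid0 1).
rewrite -addn1; apply: (Fcan_arr_braidD IHm).
(* c_{1,1} is the generator with i = k = 0. *)
have := Fcan_arr_gen 0 0; rewrite !(atens0r hS, atens0l hS).
by rewrite (atens0r FSet_left_semistrict) (atens0l FSet_left_semistrict).
Qed.

Lemma Fcan_arr_braid (m n : FSet_sk) :
  Fcan_arr (Arrow c_[m, n]) = Arrow c_[underline m : S, underline n].
Proof.
elim: m => [|m IHm]; first exact/Fcan_arr_braid_sym/(Fcan_arr_braid0 n).
rewrite -addn1; apply: (Fcan_arr_braidD IHm).
exact/Fcan_arr_braid_sym/Fcan_arr_braid1.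
Qed.

Lemma Fcan_arr_interchange (m n p q : FSet_sk) :
  Fcan_arr (Arrow (interchange m n p q))
  = Arrow (interchange (underline m : S) (underline n) (underline p) (underline q)).
Proof.
rewrite (arr_interchange FSet_left_semistrict) (arr_interchange hS).
by rewrite !Fcan_arr_atens !Fcan_arr_id Fcan_arr_braid.
Qed.

(** Induction on p, adding one summand 1 at a time: there the right
    distributor is an identity. *)
Lemma Fcan_arr_rdistr (m n p : FSet_sk) :
  Fcan_arr (Arrow d′_[m, n, p]) = Arrow d′_[underline m : S, underline n, underline p].
Proof.
elim: p => [|p IHp].
  by rewrite (arr_rdistr0 FSet_left_semistrict) Fcan_arr_id (arr_rdistr0 hS).
rewrite -addn1 (underline_add hS p 1).
rewrite (arr_rdistrD FSet_left_semistrict) (arr_rdistrD hS).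
apply: Fcan_arr_comp.
  by rewrite Fcan_arr_interchange !(underline_mul hS).
rewrite [LHS](Fcan_arr_atens (Arrow _) (Arrow _)) IHp.
rewrite (arr_rdistr1 FSet_left_semistrict) Fcan_arr_id.
rewrite atensE [in RHS](arr_rdistr1 hS _ _ : Arrow d′_[_, _, underline 1] = _).
by rewrite /aid (underline_add hS).
Qed.

(** A ⊠ id_n is the n-fold sum of A. *)
Lemma Fcan_arr_amull (A : arrow FSet_sk) (n : FSet_sk) :
  Fcan_arr (amul A (fid n)) = amul (Fcan_arr A) (aid S n).
Proof.
elim: n => [|n IHn].
  by rewrite (amul0 FSet_left_semistrict) Fcan_arr_id (amul0 hS).
rewrite -addn1 fid_add aid_add // (amul_atens FSet_left_semistrict) Fcan_arr_atens IHn.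
by rewrite (amul_atens hS) (amul1 FSet_left_semistrict) (amul1 hS).
Qed.

(** On a generator: id_n ⊠ - distributes over its three summands and maps the
    braiding c_{1,1} to c_{n,n}, which [Fcan] preserves. *)
Lemma Fcan_arr_amulr (A : arrow FSet_sk) (n : FSet_sk) :
  Fcan_arr (amul (fid n) A) = amul (aid S n) (Fcan_arr A).
Proof.
elim/arrow_gen_ind: A => [m|m p q f g ef eg|i k].
- by rewrite amul_id !Fcan_arr_id /aid amul_id (underline_mul hS).
- have -> : amul (fid n) (Arrow (g ∘ f)) = Arrow ((idm n ⊠ g) ∘ (idm n ⊠ f)).
    by rewrite -tensm_comp comp1m.
  rewrite (Fcan_arr_comp eg ef) -tensm_comp comp1m.
  by rewrite /Fcan_arr /= Fcan_comp.
- rewrite !(amul_atens FSet_left_semistrict) !Fcan_arr_atens !(amul_atens hS).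
  rewrite (amul_braid FSet_left_semistrict) !Fcan_arr_braid (amul_braid hS).
  rewrite !(underline_mul hS).
  by rewrite !amul_id !Fcan_arr_id /aid !amul_id !(underline_mul hS).
Qed.

Lemma Fcan_arr_amul (A B : arrow FSet_sk) :
  Fcan_arr (amul A B) = amul (Fcan_arr A) (Fcan_arr B).
Proof.
case: A B => [m m' f] [n n' g].
have -> : amul (Arrow f) (Arrow g) = Arrow ((f ⊠ idm n') ∘ (idm m ⊠ g)).
  by rewrite -tensm_comp comp1m compm1.
rewrite (Fcan_arr_comp (Fcan_arr_amull (Arrow f) n') (Fcan_arr_amulr (Arrow g) m)).
by rewrite -tensm_comp comp1m compm1.
Qed.

End Canonical.

(** The axioms that are not about ⊞, ⊠, braiding or right distributor compare
    identities. *)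
Lemma canonical_rig_homomorphism (S : rig_category) (hS : left_semistrict S) :
  @is_rig_homomorphism FSet_sk S underline (@Fcan S hS)
    (fun m n => eq_hom (underline_add hS m n)) (idm rig0)
    (fun m n => eq_hom (underline_mul hS m n)) (idm rig1).
Proof.
have [a l r a' l' r' d n n'] := hS.
have [fa fl fr fa' fl' fr' fd fn fn'] := FSet_left_semistrict.
have Eq := is_identity_eq_hom; have Id := IsIdentity; have F := is_identity_Fcan hS.
have tens := @is_identity_tensm; have cmp := is_identity_comp.
have iso_eq (x y : S) (e : x = y) : is_iso (eq_hom e).
  by case: y / e; apply: is_iso_id.
have iso_id := @is_iso_id S.
split; auto.
- exact: (FcanP hS).1.
- move=> m m' p p' f g; apply: arr_inj; rewrite arr_idl ?arr_idr //.
  exact: Fcan_arr_atens (Arrow f) (Arrow g).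
- by move=> x y z; apply: is_identity_unique; auto 10.
- by move=> x; apply: is_identity_unique; auto 10.
- by move=> x; apply: is_identity_unique; auto 10.
- move=> x y; apply: arr_inj; rewrite arr_idl ?arr_idr //.
  exact: Fcan_arr_braid.
- move=> m m' p p' f g; apply: arr_inj; rewrite arr_idl ?arr_idr //.
  exact: Fcan_arr_amul (Arrow f) (Arrow g).
- by move=> x y z; apply: is_identity_unique; auto 10.
- by move=> x; apply: is_identity_unique; auto 10.
- by move=> x; apply: is_identity_unique; auto 10.
- by move=> x y z; apply: is_identity_unique; auto 10.
- move=> x y z; apply: arr_inj; rewrite arr_idl ?arr_idr; auto.
  exact: Fcan_arr_rdistr.
- by move=> x; apply: is_identity_unique; auto 10.
- by move=> x; apply: is_identity_unique; auto 10.
Qed.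

(** * Conjugating the canonical homomorphism *)

Theorem proposition4p4p1 (S : rig_category) (hS : left_semistrict S)
    (x : nat -> S) (hx : forall n : nat, isomorphic (x n) (underline n))
    (tau : forall n : nat, iso (x n) (underline n)) :
  @is_rig_homomorphism FSet_sk S
    x (Ftau hS tau) (phi_add hS tau) (tau 0) (phi_mul hS tau) (tau 1).
Proof.
have := transport_rig_homomorphism (canonical_rig_homomorphism hS) tau.
(* The transported unit maps are id ∘ tau 0 and id ∘ tau 1. *)
by rewrite !comp1m.
Qed.
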